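(* Let $B: H^1 \to H^1$ be the backward shift operator $B(f)(z) = (f(z)-f(0))/z$. Then the operator norm of $B$ on $H^1$ satisfies $\|B\|_{H^1} \le 1.7047$.
   Context: $\mathbb{D}$ is the open unit disc in $\mathbb{C}$. For a continuous function $f$ on $\mathbb{D}$, $M_1(r,f) = \frac{1}{2\pi}\int_0^{2\pi} |f(re^{i\theta})|\,d\theta$. $H^1$ is the space of analytic functions $f$ on $\mathbb{D}$ with $\|f\|_{H^1} = \sup_{0\le r<1} M_1(r,f) < \infty$. The function $(f(z)-f(0))/z$ is extended analytically across $z=0$. *)

(* Defs.v *)
From Stdlib Require Import Reals.
From Coquelicot Require Import Coquelicot.

Open Scope R_scope.

(* Functions on the open unit disc are represented by total functions C -> C;
   everything below depends only on the values at points with Cmod z < 1. *)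

Definition unit_disc (z : C) : Prop := Cmod z < 1.

(* [K := C_AbsRing] makes this the complex derivative. *)
Definition analytic_on_disc (f : C -> C) : Prop :=
  forall z : C, unit_disc z -> ex_derive (K := C_AbsRing) (V := C_NormedModule) f z.

Definition M1 (r : R) (f : C -> C) : R :=
  / (2 * PI) * RInt (fun t : R => Cmod (f (r * cos t, r * sin t))) 0 (2 * PI).

Definition H1_norm (f : C -> C) : Rbar :=
  Lub_Rbar (fun y : R => exists r : R, 0 <= r < 1 /\ y = M1 r f).

Definition H1 (f : C -> C) : Prop :=
  analytic_on_disc f /\ Rbar_lt (H1_norm f) p_infty.

(* The analytic extension of (f(z) - f(0)) / z takes the value f'(0) at 0. *)
Definition backward_shift (f : C -> C) (z : C) : C :=
  if Req_dec_T (Cmod z) 0 then C_derive f 0 else ((f z - f 0) / z)%C.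

(* The supremum is taken in Rbar, so it is p_infty for an unbounded T. *)
Definition H1_op_norm (T : (C -> C) -> C -> C) : Rbar :=
  Rbar_lub (fun y : Rbar =>
    exists f : C -> C, H1 f /\ Rbar_le (H1_norm f) 1 /\ y = H1_norm (T f)).

(* Main.v *)
Require Import Defs.
From Stdlib Require Import Reals.
From Coquelicot Require Import Coquelicot.
From Stdlib Require Import Lra Lia Classical ClassicalEpsilon.

(** On the slit plane let [g] be the principal square root of [w].  AM-GM on
    [|w - 1| = |g - 1| |g + 1|] gives [|w - 1| <= 5/4 |w| + 5/4 - 3/2 Re g],
    and [Re sqrt w], extended by [0] to the negative axis, is subharmonic.
    Applied to [w = f / f(0)], its circle means are at least its value [1] at
    the centre, so [M1 s (f - f(0)) <= 5/4 M1 s f].  Circle means of [|B f|]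
    increase with the radius, so radii [s >= 3/4] suffice, and dividing by [s]
    costs at most [4/3]; finally [5/4 * 4/3 < 1.7047].  Means of subharmonic
    functions are compared through a four-point sub-mean-value inequality with
    an [O(h^3)] error, which needs only second-order Taylor expansions; these
    come from Goursat's theorem and Cauchy's formula, since [f] is only assumed
    complex differentiable at each point. *)

(** * Bisection and Goursat's theorem *)

(** Since [f] may vanish in the disc, [f / f(0)] need not have a holomorphic square root. What
    survives is free of branches: [re_sqrt w] is the larger of the real parts of the two roots of
    [w], and such a maximum is subharmonic even where the roots cannot be labelled continuously.
    This takes the place of factoring [f] into a Blaschke product and a square.

    The weights come from |g - 1| |g + 1| <= c |g - 1|^2 + |g + 1|^2 / (4 c). Once the mean of Re g
    is known to be at least 1, the terms in |f(0)| have total coefficient at most 3 / (4 c) - c, so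
    any c with c^2 >= 3/4 works. The choice c = 1 keeps everything rational; c = sqrt 3 / 2 would
    turn 5/4 into 2 / sqrt 3. The factor 4/3 is a convenience too: s may be taken as close to 1 as
    desired, and 1.7047 leaves room for s = 3/4.

    Means are compared by the maximum principle for finite sums of rotations of u. This calls for a
    notion of subharmonicity stable under sums and rotations; the four-point inequality is one, and
    it involves neither Laplacians nor double integrals. *)

Lemma nested_intervals (x c : nat -> R) :
  (forall n, x n <= x (S n)) ->
  (forall n, x (S n) + c (S n) <= x n + c n) ->
  (forall n, 0 <= c n) ->
  exists p, forall n, x n <= p <= x n + c n.
Proof.
  intros Hx Hc Hp.
  assert (Hx' : forall n k, x n <= x (n + k)%nat).
  { intros n k; induction k as [|k IH].
    - rewrite Nat.add_0_r; lra.
    - rewrite Nat.add_succ_r; specialize (Hx (n + k)%nat); lra. }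
  assert (Hc' : forall n k, x (n + k)%nat + c (n + k)%nat <= x n + c n).
  { intros n k; induction k as [|k IH].
    - rewrite Nat.add_0_r; lra.
    - rewrite Nat.add_succ_r; specialize (Hc (n + k)%nat); lra. }
  assert (Hub : forall n m, x n <= x m + c m).
  { intros n m; destruct (Nat.le_ge_cases n m) as [H|H].
    - replace m with (n + (m - n))%nat by lia.
      specialize (Hx' n (m - n)%nat); specialize (Hp (n + (m - n))%nat); lra.
    - replace n with (m + (n - m))%nat by lia.
      specialize (Hc' m (n - m)%nat); specialize (Hp (m + (n - m))%nat); lra. }
  destruct (completeness (fun y => exists n, y = x n)) as [p [Hp1 Hp2]].
  - exists (x O + c O); intros y [n ->]; apply Hub.
  - exists (x O), O; reflexivity.
  - exists p; intros n; split.
    + apply Hp1; exists n; reflexivity.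
    + apply Hp2; intros y [m ->]; apply Hub.
Qed.

(* [P x y l] is a property of the rectangle [[x, x + l a] * [y, y + l b]]. *)
Lemma rectangle_bisection (P : R -> R -> R -> Prop) (x0 y0 a b : R) :
  0 < a -> 0 < b ->
  (forall x y l, 0 < l -> x0 <= x -> x + l * a <= x0 + a ->
    y0 <= y -> y + l * b <= y0 + b ->
    P x y (l / 2) -> P (x + l / 2 * a) y (l / 2) ->
    P x (y + l / 2 * b) (l / 2) -> P (x + l / 2 * a) (y + l / 2 * b) (l / 2) ->
    P x y l) ->
  (forall p q, x0 <= p <= x0 + a -> y0 <= q <= y0 + b ->
    exists d, 0 < d /\ forall x y l, 0 < l < d ->
      x <= p <= x + l * a -> y <= q <= y + l * b ->
      x0 <= x -> x + l * a <= x0 + a -> y0 <= y -> y + l * b <= y0 + b ->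
      P x y l) ->
  P x0 y0 1.
Proof.
  intros Ha Hb Hsplit Hloc; apply NNPP; intros Hn.
  set (Good := fun (l : R) (v : R * R) =>
    0 < l /\ x0 <= fst v /\ fst v + l * a <= x0 + a /\
    y0 <= snd v /\ snd v + l * b <= y0 + b /\ ~ P (fst v) (snd v) l).
  set (Next := fun (l : R) (v w : R * R) =>
    Good (l / 2) w /\
    fst v <= fst w /\ fst w + l / 2 * a <= fst v + l * a /\
    snd v <= snd w /\ snd w + l / 2 * b <= snd v + l * b).
  (* If no quarter of a bad rectangle were bad, [Hsplit] would make the rectangle itself good. The
     implication is kept under the existential so that [choice] applies to all pairs, with [v] as a
     dummy witness when [Good] fails. *)
  assert (Hstep : forall l v, exists w, Good l v -> Next l v w).
  { intros l v; destruct (classic (Good l v)) as [H|H]; [|exists v; tauto].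
    apply NNPP; intros Hw; destruct v as [x y].
    destruct H as (Hl & H1 & H2 & H3 & H4 & H5); simpl in *.
    assert (0 < l * a) by (apply Rmult_lt_0_compat; lra).
    assert (0 < l * b) by (apply Rmult_lt_0_compat; lra).
    assert (Hc : forall w, Next l (x, y) w -> False)
      by (intros w Hw'; apply Hw; exists w; tauto).
    apply H5, Hsplit; try assumption; apply NNPP; intros HP;
    [ apply (Hc (x, y)) | apply (Hc (x + l / 2 * a, y))
    | apply (Hc (x, y + l / 2 * b)) | apply (Hc (x + l / 2 * a, y + l / 2 * b)) ];
    unfold Next, Good; simpl; repeat split; try assumption; lra. }
  destruct (choice (fun (lv : R * (R * R)) w =>
    Good (fst lv) (snd lv) -> Next (fst lv) (snd lv) w)) as [g Hg].
  { intros [l v]; apply Hstep. }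
  set (s := fix s n := match n with
    | O => (x0, y0) | S n => g (/ 2 ^ n, s n) end).
  assert (Hhalf : forall n, / 2 ^ S n = / 2 ^ n / 2).
  { intros n; simpl; field; apply pow_nonzero; lra. }
  assert (Hs : forall n, Good (/ 2 ^ n) (s n)).
  { intros n; induction n as [|n IH].
    - unfold Good; simpl; repeat split; try lra.
      replace (/ 1) with 1 by field; exact Hn.
    - rewrite Hhalf; exact (proj1 (Hg (/ 2 ^ n, s n) IH)). }
  assert (Hs' : forall n, Next (/ 2 ^ n) (s n) (s (S n))).
  { intros n; exact (Hg (/ 2 ^ n, s n) (Hs n)). }
  assert (Hpos : forall n, 0 < / 2 ^ n)
    by (intros n; apply Rinv_0_lt_compat, pow_lt; lra).
  destruct (nested_intervals (fun n => fst (s n)) (fun n => / 2 ^ n * a)) as [p Hp].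
  { intros n; apply (Hs' n). }
  { intros n; rewrite Hhalf; apply (Hs' n). }
  { intros n; apply Rmult_le_pos; [left; apply Hpos | lra]. }
  destruct (nested_intervals (fun n => snd (s n)) (fun n => / 2 ^ n * b)) as [q Hq].
  { intros n; apply (Hs' n). }
  { intros n; rewrite Hhalf; apply (Hs' n). }
  { intros n; apply Rmult_le_pos; [left; apply Hpos | lra]. }
  destruct (Hloc p q) as [d [Hd HP]].
  { specialize (Hp O); simpl in Hp; rewrite Rinv_1 in Hp; lra. }
  { specialize (Hq O); simpl in Hq; rewrite Rinv_1 in Hq; lra. }
  destruct (pow_lt_1_zero (/ 2)) with (y := d) as [N HN]; [|lra|].
  { rewrite Rabs_pos_eq; lra. }
  specialize (HN N (Nat.le_refl N)).
  rewrite pow_inv, Rabs_pos_eq in HN by (left; rewrite ?pow_inv; apply Hpos).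
  destruct (Hs N) as (H0 & H1 & H2 & H3 & H4 & H5).
  apply H5, HP; auto.
Qed.

(** Compactness enters as [Hcover]: a class [Q] of upper bounds that is closed under [Rmax] and
    holds locally yields a global bound. With [Q] trivial it gives boundedness; with [Q M] meaning
    [M < S], where [S] is the supremum, it shows that an unattained supremum could be lowered. *)
Lemma rectangle_max (g : R -> R -> R) (x0 y0 a b : R) :
  0 < a -> 0 < b ->
  (forall p q, x0 <= p <= x0 + a -> y0 <= q <= y0 + b ->
    forall e, 0 < e -> exists d, 0 < d /\
    forall x y, x0 <= x <= x0 + a -> y0 <= y <= y0 + b ->
      Rabs (x - p) < d -> Rabs (y - q) < d -> Rabs (g x y - g p q) < e) ->
  exists p q, x0 <= p <= x0 + a /\ y0 <= q <= y0 + b /\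
    forall x y, x0 <= x <= x0 + a -> y0 <= y <= y0 + b -> g x y <= g p q.
Proof.
  intros Ha Hb Hg.
  set (InR := fun x y l u v => x <= u <= x + l * a /\ y <= v <= y + l * b).
  assert (Hin : forall x y l u v, InR x y l u v ->
    InR x y (l / 2) u v \/ InR (x + l / 2 * a) y (l / 2) u v \/
    InR x (y + l / 2 * b) (l / 2) u v \/
    InR (x + l / 2 * a) (y + l / 2 * b) (l / 2) u v).
  { unfold InR; intros x y l u v H.
    destruct (Rle_dec u (x + l / 2 * a)); destruct (Rle_dec v (y + l / 2 * b));
    [left | right; right; left | right; left | right; right; right]; lra. }
  assert (Hcover : forall Q : R -> Prop,
    (forall M M', Q M -> Q M' -> Q (Rmax M M')) ->
    (forall p q, x0 <= p <= x0 + a -> y0 <= q <= y0 + b ->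
      exists M, g p q < M /\ Q M) ->
    exists M, Q M /\ forall x y, x0 <= x <= x0 + a -> y0 <= y <= y0 + b -> g x y <= M).
  { intros Q Hmax HQ.
    destruct (rectangle_bisection
      (fun x y l => exists M, Q M /\ forall u v, InR x y l u v -> g u v <= M)
      x0 y0 a b Ha Hb) as [M [HM1 HM2]].
    - intros x y l _ _ _ _ _ [M1 [Q1 H1]] [M2 [Q2 H2]] [M3 [Q3 H3]] [M4 [Q4 H4]].
      exists (Rmax (Rmax M1 M2) (Rmax M3 M4)); split; [auto|].
      intros u v H.
      pose proof (Rmax_l (Rmax M1 M2) (Rmax M3 M4));
      pose proof (Rmax_r (Rmax M1 M2) (Rmax M3 M4));
      pose proof (Rmax_l M1 M2); pose proof (Rmax_r M1 M2);
      pose proof (Rmax_l M3 M4); pose proof (Rmax_r M3 M4).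
      destruct (Hin _ _ _ _ _ H) as [K|[K|[K|K]]];
      [apply H1 in K | apply H2 in K | apply H3 in K | apply H4 in K]; lra.
    - intros p q Hp Hq; destruct (HQ p q Hp Hq) as [M [HM QM]].
      destruct (Hg p q Hp Hq (M - g p q)) as [d [Hd Hd']]; [lra|].
      exists (d / (a + b)); split; [apply Rdiv_lt_0_compat; lra|].
      intros x y l [Hl1 Hl2] Hx Hy H1 H2 H3 H4; exists M; split; [exact QM|].
      intros u v [Hu Hv].
      assert (Hlab : l * (a + b) < d).
      { apply Rmult_lt_compat_r with (r := a + b) in Hl2; [|lra].
        unfold Rdiv in Hl2; rewrite Rmult_assoc, Rinv_l in Hl2; lra. }
      assert (0 < l * a) by (apply Rmult_lt_0_compat; lra).
      assert (0 < l * b) by (apply Rmult_lt_0_compat; lra).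
      assert (Hd2 : Rabs (g u v - g p q) < M - g p q).
      { apply Hd'; try lra; apply Rabs_def1; lra. }
      apply Rabs_def2 in Hd2; lra.
    - exists M; split; [exact HM1|].
      intros x y Hx Hy; apply HM2; unfold InR; lra. }
  destruct (Hcover (fun _ => True)) as [B [_ HB]]; auto.
  { intros p q _ _; exists (g p q + 1); split; [lra|trivial]. }
  destruct (completeness (fun z => exists x y, x0 <= x <= x0 + a /\
    y0 <= y <= y0 + b /\ z = g x y)) as [S [HS1 HS2]].
  { exists B; intros z (x & y & Hx & Hy & ->); auto. }
  { exists (g x0 y0), x0, y0; repeat split; lra. }
  apply NNPP; intros Hno.
  destruct (Hcover (fun M => M < S)) as [M [HM1 HM2]].
  - intros M M' H H'; apply Rmax_lub_lt; assumption.
  - intros p q Hp Hq.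
    assert (g p q < S).
    { destruct (HS1 (g p q)) as [H|H]; [exists p, q; auto | exact H |].
      exfalso; apply Hno; exists p, q; repeat split; try lra.
      intros x y Hx Hy; rewrite H; apply HS1; exists x, y; auto. }
    exists ((g p q + S) / 2); lra.
  - assert (S <= M); [|lra].
    apply HS2; intros z (x & y & Hx & Hy & ->); auto.
Qed.

Definition has_gradient (F : R -> R -> R) (p q a b : R) : Prop :=
  forall e, 0 < e -> exists d, 0 < d /\
  forall x y, Rabs (x - p) < d -> Rabs (y - q) < d ->
  Rabs (F x y - F p q - a * (x - p) - b * (y - q)) <= e * (Rabs (x - p) + Rabs (y - q)).

Lemma has_gradient_continuous (F : R -> R -> R) (p q a b : R) :
  has_gradient F p q a b -> forall e, 0 < e -> exists d, 0 < d /\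
  forall x y, Rabs (x - p) < d -> Rabs (y - q) < d -> Rabs (F x y - F p q) < e.
Proof.
  intros H e He; destruct (H 1 Rlt_0_1) as [d [Hd Hd']].
  pose proof (Rabs_pos a) as Ha; pose proof (Rabs_pos b) as Hb.
  set (K := 3 + Rabs a + Rabs b).
  exists (Rmin d (e / K)).
  assert (HeK : 0 < e / K) by (apply Rdiv_lt_0_compat; unfold K; lra).
  split; [apply Rmin_pos; assumption|].
  intros x y Hx Hy.
  pose proof (Rmin_l d (e / K)); pose proof (Rmin_r d (e / K)).
  specialize (Hd' x y ltac:(lra) ltac:(lra)).
  pose proof (Rabs_pos (x - p)); pose proof (Rabs_pos (y - q)).
  replace (F x y - F p q) with
    ((F x y - F p q - a * (x - p) - b * (y - q)) + (a * (x - p) + b * (y - q))) by ring.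
  eapply Rle_lt_trans; [apply Rabs_triang|].
  eapply Rle_lt_trans; [apply Rplus_le_compat; [apply Hd'|apply Rabs_triang]|].
  rewrite !Rabs_mult.
  assert (Rabs a * Rabs (x - p) <= Rabs a * (e / K)) by (apply Rmult_le_compat_l; lra).
  assert (Rabs b * Rabs (y - q) <= Rabs b * (e / K)) by (apply Rmult_le_compat_l; lra).
  assert (K * (e / K) = e) by (field; unfold K; lra).
  unfold K in *; lra.
Qed.

Lemma continuous_eps (v : R -> R) (x : R) :
  (forall e, 0 < e -> exists d, 0 < d /\
    forall y, Rabs (y - x) < d -> Rabs (v y - v x) < e) -> continuous v x.
Proof.
  intros H; apply filterlim_locally; intros e.
  destruct (H e (cond_pos e)) as [d [Hd Hd']].
  exists (mkposreal d Hd); intros y Hy; apply Hd'; exact Hy.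
Qed.

(* Goursat's theorem for the real form [X dx + Y dy]: it suffices that the form
   is closed at each point, with no continuity of the derivatives. *)
Lemma goursat_rectangle (X Y : R -> R -> R) (x0 y0 a b : R) :
  0 < a -> 0 < b ->
  (forall p q, x0 <= p <= x0 + a -> y0 <= q <= y0 + b ->
    exists c u v, has_gradient X p q u c /\ has_gradient Y p q c v) ->
  RInt (Y (x0 + a)) y0 (y0 + b) - RInt (Y x0) y0 (y0 + b) =
  RInt (fun x => X x (y0 + b)) x0 (x0 + a) - RInt (fun x => X x y0) x0 (x0 + a).
Proof.
  intros Ha Hb Hgrad.
  assert (HY : forall x y y', x0 <= x <= x0 + a -> y0 <= y -> y <= y' ->
    y' <= y0 + b -> ex_RInt (Y x) y y').
  { intros x y y' Hx H1 H2 H3; apply (ex_RInt_continuous (V := R_CompleteNormedModule)).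
    intros q Hq; rewrite Rmin_left, Rmax_right in Hq by lra.
    destruct (Hgrad x q) as (c & u & v & _ & Hc); [lra|lra|].
    apply continuous_eps; intros e He.
    destruct (has_gradient_continuous _ _ _ _ _ Hc e He) as [d [Hd Hd']].
    exists d; split; [exact Hd|]; intros z Hz; apply Hd'; [|exact Hz].
    rewrite Rminus_diag, Rabs_R0; exact Hd. }
  assert (HX : forall y x x', y0 <= y <= y0 + b -> x0 <= x -> x <= x' ->
    x' <= x0 + a -> ex_RInt (fun x => X x y) x x').
  { intros y x x' Hx H1 H2 H3; apply (ex_RInt_continuous (V := R_CompleteNormedModule)).
    intros q Hq; rewrite Rmin_left, Rmax_right in Hq by lra.
    destruct (Hgrad q y) as (c & u & v & Hc & _); [lra|lra|].
    apply continuous_eps; intros e He.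
    destruct (has_gradient_continuous _ _ _ _ _ Hc e He) as [d [Hd Hd']].
    exists d; split; [exact Hd|]; intros z Hz; apply Hd'; [exact Hz|].
    rewrite Rminus_diag, Rabs_R0; exact Hd. }
  (* [J] is the circulation of the form around the subrectangle of scale [l]; it is additive when
     the rectangle is quartered. *)
  set (J := fun x y l =>
    (RInt (Y (x + l * a)) y (y + l * b) - RInt (Y x) y (y + l * b)) -
    (RInt (fun t => X t (y + l * b)) x (x + l * a) - RInt (fun t => X t y) x (x + l * a))).
  (* A bound by [e] times the squared scale passes from the quarters to the whole because 4 (l/2)^2
     = l^2. *)
  assert (HJ : forall e, 0 < e -> Rabs (J x0 y0 1) <= e * (1 * 1)).
  { intros e He.
    apply (rectangle_bisection (fun x y l => Rabs (J x y l) <= e * (l * l)) x0 y0 a b Ha Hb).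
    - intros x y l Hl H1 H2 H3 H4.
      assert (0 < l * a) by (apply Rmult_lt_0_compat; lra).
      assert (0 < l * b) by (apply Rmult_lt_0_compat; lra).
      assert (HE : J x y l = J x y (l / 2) + J (x + l / 2 * a) y (l / 2) +
        J x (y + l / 2 * b) (l / 2) + J (x + l / 2 * a) (y + l / 2 * b) (l / 2)).
      { unfold J.
        replace (x + l / 2 * a + l / 2 * a) with (x + l * a) by field.
        replace (y + l / 2 * b + l / 2 * b) with (y + l * b) by field.
        rewrite <- (RInt_Chasles (Y (x + l * a)) y (y + l / 2 * b) (y + l * b))
          by (apply HY; lra).
        rewrite <- (RInt_Chasles (Y x) y (y + l / 2 * b) (y + l * b))
          by (apply HY; lra).
        rewrite <- (RInt_Chasles (fun t => X t (y + l * b)) x (x + l / 2 * a) (x + l * a))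
          by (apply HX; lra).
        rewrite <- (RInt_Chasles (fun t => X t y) x (x + l / 2 * a) (x + l * a))
          by (apply HX; lra).
        unfold plus; simpl; ring. }
      intros K1 K2 K3 K4; rewrite HE.
      eapply Rle_trans; [apply Rabs_triang|].
      pose proof (Rabs_triang (J x y (l / 2) + J (x + l / 2 * a) y (l / 2)) (J x (y + l / 2 * b) (l / 2))).
      pose proof (Rabs_triang (J x y (l / 2)) (J (x + l / 2 * a) y (l / 2))).
      assert (e * (l * l) = 4 * (e * (l / 2 * (l / 2)))) by field.
      lra.
    - intros p q Hp Hq.
      destruct (Hgrad p q Hp Hq) as (c & u & v & HXg & HYg).
      (* Each pair of opposite sides contributes its length, [l * a] or [l * b], times
         [2 * (e' * (l * (a + b)))]; with this [e'] the two add up to exactly [e * (l * l)]. *)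
      set (e' := e / (2 * (a + b) * (a + b))).
      assert (He' : 0 < e').
      { apply Rdiv_lt_0_compat; [lra|]; repeat apply Rmult_lt_0_compat; lra. }
      destruct (HXg e' He') as [d1 [Hd1 HX1]].
      destruct (HYg e' He') as [d2 [Hd2 HY1]].
      exists (Rmin d1 d2 / (a + b)).
      pose proof (Rmin_l d1 d2); pose proof (Rmin_r d1 d2).
      pose proof (Rmin_pos d1 d2 Hd1 Hd2).
      split; [apply Rdiv_lt_0_compat; lra|].
      intros x y l [Hl1 Hl2] Hx Hy B1 B2 B3 B4.
      assert (Hlab : l * (a + b) < Rmin d1 d2).
      { apply Rmult_lt_compat_r with (r := a + b) in Hl2; [|lra].
        unfold Rdiv in Hl2; rewrite Rmult_assoc, Rinv_l in Hl2; lra. }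
      assert (Hla : 0 < l * a) by (apply Rmult_lt_0_compat; lra).
      assert (Hlb : 0 < l * b) by (apply Rmult_lt_0_compat; lra).
      assert (Hnear : forall t s, x <= t <= x + l * a -> y <= s <= y + l * b ->
        Rabs (t - p) <= l * a /\ Rabs (s - q) <= l * b).
      { intros t s Ht Hs; split; apply Rabs_le; lra. }
      assert (HXe : forall t s, x <= t <= x + l * a -> y <= s <= y + l * b ->
        Rabs (X t s - X p q - u * (t - p) - c * (s - q)) <= e' * (l * (a + b))).
      { intros t s Ht Hs; destruct (Hnear t s Ht Hs).
        eapply Rle_trans; [apply HX1; lra|].
        apply Rmult_le_compat_l; lra. }
      assert (HYe : forall t s, x <= t <= x + l * a -> y <= s <= y + l * b ->
        Rabs (Y t s - Y p q - c * (t - p) - v * (s - q)) <= e' * (l * (a + b))).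
      { intros t s Ht Hs; destruct (Hnear t s Ht Hs).
        eapply Rle_trans; [apply HY1; lra|].
        apply Rmult_le_compat_l; lra. }
      assert (E1 : ex_RInt (Y (x + l * a)) y (y + l * b)) by (apply HY; lra).
      assert (E2 : ex_RInt (Y x) y (y + l * b)) by (apply HY; lra).
      assert (E3 : ex_RInt (fun t => X t (y + l * b)) x (x + l * a)) by (apply HX; lra).
      assert (E4 : ex_RInt (fun t => X t y) x (x + l * a)) by (apply HX; lra).
      (* The linear part of [Y] integrates to [c] times the area of the rectangle, and so does that
         of [X] in [I2]. Closedness, the shared [c], makes them cancel in [J], leaving only the
         errors. *)
      assert (I1 : RInt (fun s => (Y (x + l * a) s - Y x s) - c * (l * a)) y (y + l * b) =
        RInt (Y (x + l * a)) y (y + l * b) - RInt (Y x) y (y + l * b) - l * b * (c * (l * a))).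
      { rewrite (RInt_minus (V := R_CompleteNormedModule) (fun s => Y (x + l * a) s - Y x s)
          (fun _ => c * (l * a))); [|apply (ex_RInt_minus (V := R_NormedModule)); assumption
          |apply ex_RInt_const].
        rewrite (RInt_minus (V := R_CompleteNormedModule) (Y (x + l * a)) (Y x)) by assumption.
        rewrite RInt_const; unfold minus, plus, opp, scal; simpl; unfold mult; simpl; ring. }
      assert (I2 : RInt (fun t => (X t (y + l * b) - X t y) - c * (l * b)) x (x + l * a) =
        RInt (fun t => X t (y + l * b)) x (x + l * a) - RInt (fun t => X t y) x (x + l * a)
        - l * a * (c * (l * b))).
      { rewrite (RInt_minus (V := R_CompleteNormedModule) (fun t => X t (y + l * b) - X t y)
          (fun _ => c * (l * b))); [|apply (ex_RInt_minus (V := R_NormedModule)); assumption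
          |apply ex_RInt_const].
        rewrite (RInt_minus (V := R_CompleteNormedModule) (fun t => X t (y + l * b)) (fun t => X t y))
          by assumption.
        rewrite RInt_const; unfold minus, plus, opp, scal; simpl; unfold mult; simpl; ring. }
      assert (N1 : Rabs (RInt (fun s => (Y (x + l * a) s - Y x s) - c * (l * a)) y (y + l * b))
        <= (y + l * b - y) * (2 * (e' * (l * (a + b))))).
      { apply abs_RInt_le_const; [lra| |].
        - apply (ex_RInt_minus (V := R_NormedModule) (fun s => Y (x + l * a) s - Y x s));
          [apply (ex_RInt_minus (V := R_NormedModule)); assumption | apply ex_RInt_const].
        - intros s Hs.
          pose proof (HYe (x + l * a) s ltac:(lra) ltac:(lra)) as U1.
          pose proof (HYe x s ltac:(lra) ltac:(lra)) as U2.
          apply Rabs_le_between in U1; apply Rabs_le_between in U2; apply Rabs_le_between.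
          lra. }
      assert (N2 : Rabs (RInt (fun t => (X t (y + l * b) - X t y) - c * (l * b)) x (x + l * a))
        <= (x + l * a - x) * (2 * (e' * (l * (a + b))))).
      { apply abs_RInt_le_const; [lra| |].
        - apply (ex_RInt_minus (V := R_NormedModule) (fun t => X t (y + l * b) - X t y));
          [apply (ex_RInt_minus (V := R_NormedModule)); assumption | apply ex_RInt_const].
        - intros t Ht.
          pose proof (HXe t (y + l * b) ltac:(lra) ltac:(lra)) as U1.
          pose proof (HXe t y ltac:(lra) ltac:(lra)) as U2.
          apply Rabs_le_between in U1; apply Rabs_le_between in U2; apply Rabs_le_between.
          lra. }
      rewrite I1 in N1; rewrite I2 in N2.
      apply Rabs_le_between in N1; apply Rabs_le_between in N2.
      assert (e * (l * l) = (y + l * b - y) * (2 * (e' * (l * (a + b)))) +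
        (x + l * a - x) * (2 * (e' * (l * (a + b))))).
      { unfold e'; field; lra. }
      apply Rabs_le_between; unfold J; lra. }
  assert (H0 : J x0 y0 1 = 0).
  { destruct (Req_dec (J x0 y0 1) 0) as [H|H]; [exact H|].
    apply Rabs_pos_lt in H.
    specialize (HJ (Rabs (J x0 y0 1) / 2) ltac:(lra)); lra. }
  unfold J in H0; rewrite !Rmult_1_l in H0; lra.
Qed.

(** * Cauchy's formula *)

(* [n] is the distance to the base point; leaving [T] and [n] open gives one calculus
   for functions of one real, two real and one complex variable. *)
Definition expands {T : Type} (n : T -> R) (F : T -> C) (c : C) (L : T -> C) : Prop :=
  (exists K, 0 <= K /\ forall p, Cmod (L p) <= K * n p) /\
  forall e, 0 < e -> exists d, 0 < d /\
    forall p, n p < d -> Cmod (F p - c - L p) <= e * n p.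

Lemma expands_ext {T : Type} (n : T -> R) (F F' : T -> C) (c c' : C) (L L' : T -> C) :
  (forall p, F p = F' p) -> c = c' -> (forall p, L p = L' p) ->
  expands n F c L -> expands n F' c' L'.
Proof.
  intros HF <- HL [[K [HK H1]] H2]; split.
  - exists K; split; [exact HK|]; intros p; rewrite <- HL; apply H1.
  - intros e He; destruct (H2 e He) as [d [Hd H]]; exists d; split; [exact Hd|].
    intros p; rewrite <- HL, <- HF; apply H.
Qed.

Lemma expands_lipschitz {T : Type} (n : T -> R) (F : T -> C) (c : C) (L : T -> C) :
  expands n F c L ->
  exists K d, 0 < K /\ 0 < d /\ forall p, n p < d -> Cmod (F p - c) <= K * n p.
Proof.
  intros [[K [HK H1]] H2]; destruct (H2 1 Rlt_0_1) as [d [Hd H]].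
  exists (K + 1), d; repeat split; [lra|exact Hd|].
  intros p Hp; specialize (H p Hp); specialize (H1 p).
  replace (F p - c)%C with ((F p - c - L p) + L p)%C by ring.
  eapply Rle_trans; [apply Cmod_triangle|]; lra.
Qed.

Lemma expands_const {T : Type} (n : T -> R) (c : C) :
  (forall p, 0 <= n p) -> expands n (fun _ => c) c (fun _ => 0).
Proof.
  intros Hn; split.
  - exists 0; split; [lra|]; intros p; rewrite Cmod_0; lra.
  - intros e He; exists 1; split; [lra|]; intros p _.
    replace (c - c - 0)%C with (RtoC 0) by ring.
    rewrite Cmod_0; apply Rmult_le_pos; [lra|apply Hn].
Qed.

Lemma expands_plus {T : Type} (n : T -> R) (F G : T -> C) (c d : C) (L M : T -> C) :
  expands n F c L -> expands n G d M ->
  expands n (fun p => F p + G p)%C (c + d) (fun p => L p + M p)%C.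
Proof.
  intros [[K [HK H1]] H2] [[K' [HK' H1']] H2']; split.
  - exists (K + K'); split; [lra|]; intros p.
    eapply Rle_trans; [apply Cmod_triangle|]; specialize (H1 p); specialize (H1' p); lra.
  - intros e He; destruct (H2 (e / 2)) as [d1 [Hd1 E1]]; [lra|].
    destruct (H2' (e / 2)) as [d2 [Hd2 E2]]; [lra|].
    exists (Rmin d1 d2); split; [apply Rmin_pos; assumption|].
    intros p Hp; pose proof (Rmin_l d1 d2); pose proof (Rmin_r d1 d2).
    specialize (E1 p ltac:(lra)); specialize (E2 p ltac:(lra)).
    replace (F p + G p - (c + d) - (L p + M p))%C with
      ((F p - c - L p) + (G p - d - M p))%C by ring.
    eapply Rle_trans; [apply Cmod_triangle|]; lra.
Qed.

Lemma expands_mult {T : Type} (n : T -> R) (F G : T -> C) (c d : C) (L M : T -> C) :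
  (forall p, 0 <= n p) -> expands n F c L -> expands n G d M ->
  expands n (fun p => F p * G p)%C (c * d) (fun p => c * M p + L p * d)%C.
Proof.
  intros Hn HF HG.
  destruct (expands_lipschitz _ _ _ _ HF) as (K1 & r1 & HK1 & Hr1 & Lip1).
  destruct (expands_lipschitz _ _ _ _ HG) as (K2 & r2 & HK2 & Hr2 & Lip2).
  destruct HF as [[K [HK H1]] H2]; destruct HG as [[K' [HK' H1']] H2'].
  pose proof (Cmod_ge_0 c) as Hc; pose proof (Cmod_ge_0 d) as Hd; split.
  - exists (Cmod c * K' + K * Cmod d); split.
    { apply Rplus_le_le_0_compat; apply Rmult_le_pos; lra. }
    intros p; eapply Rle_trans; [apply Cmod_triangle|]; rewrite !Cmod_mult.
    pose proof (Rmult_le_compat_l _ _ _ Hc (H1' p)).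
    pose proof (Rmult_le_compat_r _ _ _ Hd (H1 p)). lra.
  - intros e He.
    set (Q := 1 + Cmod c + Cmod d).
    assert (HQ : 0 < e / Q / 2).
    { apply Rdiv_lt_0_compat; [apply Rdiv_lt_0_compat|]; unfold Q; lra. }
    destruct (H2 _ HQ) as [d1 [Hd1 E1]]; destruct (H2' _ HQ) as [d2 [Hd2 E2]].
    set (d3 := e / 2 / (K1 * K2)).
    assert (Hd3 : 0 < d3).
    { apply Rdiv_lt_0_compat; [lra|apply Rmult_lt_0_compat; lra]. }
    exists (Rmin (Rmin d1 d2) (Rmin (Rmin r1 r2) d3)).
    split; [repeat apply Rmin_pos; assumption|].
    intros p Hp.
    pose proof (Rmin_l (Rmin d1 d2) (Rmin (Rmin r1 r2) d3)).
    pose proof (Rmin_r (Rmin d1 d2) (Rmin (Rmin r1 r2) d3)).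
    pose proof (Rmin_l d1 d2); pose proof (Rmin_r d1 d2).
    pose proof (Rmin_l (Rmin r1 r2) d3); pose proof (Rmin_r (Rmin r1 r2) d3).
    pose proof (Rmin_l r1 r2); pose proof (Rmin_r r1 r2).
    specialize (E1 p ltac:(lra)); specialize (E2 p ltac:(lra)).
    specialize (Lip1 p ltac:(lra)); specialize (Lip2 p ltac:(lra)).
    specialize (Hn p).
    replace (F p * G p - c * d - (c * M p + L p * d))%C with
      ((F p - c) * (G p - d) + (c * (G p - d - M p) + (F p - c - L p) * d))%C by ring.
    eapply Rle_trans; [apply Cmod_triangle|].
    eapply Rle_trans; [apply Rplus_le_compat_l, Cmod_triangle|].
    rewrite !Cmod_mult.
    assert (Cmod (F p - c) * Cmod (G p - d) <= (K1 * n p) * (K2 * n p))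
      by (apply Rmult_le_compat; try apply Cmod_ge_0; assumption).
    assert ((K1 * n p) * (K2 * n p) <= e / 2 * n p).
    { replace ((K1 * n p) * (K2 * n p)) with ((K1 * K2 * n p) * n p) by ring.
      apply Rmult_le_compat_r; [exact Hn|].
      replace (e / 2) with (K1 * K2 * d3) by (unfold d3; field; split; lra).
      apply Rmult_le_compat_l; [apply Rmult_le_pos|]; lra. }
    pose proof (Rmult_le_compat_l _ _ _ Hc E2).
    pose proof (Rmult_le_compat_r _ _ _ Hd E1).
    assert ((Cmod c + Cmod d) * (e / Q / 2 * n p) <= e / 2 * n p).
    { replace (e / 2 * n p) with (Q * (e / Q / 2 * n p)) by (field; unfold Q; lra).
      apply Rmult_le_compat_r; [apply Rmult_le_pos; lra|unfold Q; lra]. }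
    lra.
Qed.

(** Stating complex differentiability as an expansion makes [expands_comp] the one chain rule for
    curves, homotopies and holomorphic compositions. *)
Definition cderiv (f : C -> C) (z l : C) : Prop :=
  expands (fun w => Cmod (w - z)) f (f z) (fun w => l * (w - z))%C.

Lemma expands_comp {T : Type} (n : T -> R) (f : C -> C) (F : T -> C) (c l : C) (L : T -> C) :
  (forall p, 0 <= n p) -> expands n F c L -> cderiv f c l ->
  expands n (fun p => f (F p)) (f c) (fun p => l * L p)%C.
Proof.
  intros Hn HF [_ Hf].
  destruct (expands_lipschitz _ _ _ _ HF) as (K1 & r1 & HK1 & Hr1 & Lip1).
  destruct HF as [[K [HK H1]] H2]; pose proof (Cmod_ge_0 l) as Hl; split.
  - exists (Cmod l * K); split; [apply Rmult_le_pos; lra|].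
    intros p; rewrite Cmod_mult, Rmult_assoc; apply Rmult_le_compat_l; auto.
  - intros e He.
    destruct (Hf (e / 2 / K1)) as [d1 [Hd1 E1]].
    { apply Rdiv_lt_0_compat; lra. }
    destruct (H2 (e / 2 / (1 + Cmod l))) as [d2 [Hd2 E2]].
    { apply Rdiv_lt_0_compat; lra. }
    assert (Hd3 : 0 < d1 / K1) by (apply Rdiv_lt_0_compat; lra).
    exists (Rmin (Rmin (d1 / K1) d2) r1); split; [repeat apply Rmin_pos; assumption|].
    intros p Hp.
    pose proof (Rmin_l (Rmin (d1 / K1) d2) r1); pose proof (Rmin_r (Rmin (d1 / K1) d2) r1).
    pose proof (Rmin_l (d1 / K1) d2); pose proof (Rmin_r (d1 / K1) d2).
    specialize (Lip1 p ltac:(lra)); specialize (E2 p ltac:(lra)); specialize (Hn p).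
    assert (HFd : Cmod (F p - c) < d1).
    { eapply Rle_lt_trans; [exact Lip1|].
      replace d1 with (K1 * (d1 / K1)) by (field; lra).
      apply Rmult_lt_compat_l; lra. }
    specialize (E1 _ HFd).
    replace (f (F p) - f c - l * L p)%C with
      ((f (F p) - f c - l * (F p - c)) + l * (F p - c - L p))%C by ring.
    eapply Rle_trans; [apply Cmod_triangle|]; rewrite Cmod_mult.
    assert (e / 2 / K1 * Cmod (F p - c) <= e / 2 * n p).
    { replace (e / 2 * n p) with (e / 2 / K1 * (K1 * n p)) by (field; lra).
      apply Rmult_le_compat_l; [|exact Lip1]. left; apply Rdiv_lt_0_compat; lra. }
    assert (Cmod l * Cmod (F p - c - L p) <= e / 2 * n p).
    { replace (e / 2 * n p) with ((1 + Cmod l) * (e / 2 / (1 + Cmod l) * n p)) by (field; lra).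
      apply Rmult_le_compat; try apply Cmod_ge_0; lra. }
    lra.
Qed.

Lemma Cmod_minus_ge (z w : C) : Cmod z - Cmod w <= Cmod (z - w).
Proof.
  pose proof (Cmod_triangle (z - w) w) as H.
  replace (z - w + w)%C with z in H by ring; lra.
Qed.

Lemma Cmod_minus_sym (z w : C) : Cmod (z - w) = Cmod (w - z).
Proof. rewrite <- Cmod_opp; f_equal; ring. Qed.

Lemma cderiv_inv (z : C) : z <> 0 -> cderiv Cinv z (- / (z * z)).
Proof.
  intros Hz; pose proof (proj1 (Cmod_gt_0 z) Hz) as Hm; split.
  - exists (Cmod (- / (z * z))); split; [apply Cmod_ge_0|]; intros p; rewrite Cmod_mult; lra.
  - intros e He.
    set (m := Cmod z) in *.
    assert (Hm3 : 0 < m * m * m) by (repeat apply Rmult_lt_0_compat; exact Hm).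
    exists (Rmin (m / 2) (e * (m * m * m) / 2)); split.
    { apply Rmin_pos; [lra|]. apply Rdiv_lt_0_compat; [apply Rmult_lt_0_compat|]; lra. }
    intros w Hw.
    pose proof (Rmin_l (m / 2) (e * (m * m * m) / 2)).
    pose proof (Rmin_r (m / 2) (e * (m * m * m) / 2)).
    assert (Hw2 : m / 2 <= Cmod w).
    { pose proof (Cmod_minus_ge z w) as H1; rewrite Cmod_minus_sym in H1; fold m in H1; lra. }
    assert (Hw0 : w <> 0) by (intros ->; rewrite Cmod_0 in Hw2; lra).
    (* The remainder is exactly (w - z)^2 / (z^2 w), and |w| >= m/2 controls its denominator. *)
    replace (/ w - / z - - / (z * z) * (w - z))%C with
      ((w - z) * ((w - z) * / (z * z * w)))%C by (field; split; assumption).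
    rewrite (Cmod_mult (w - z) (_ * _)), Rmult_comm.
    apply Rmult_le_compat_r; [apply Cmod_ge_0|].
    rewrite Cmod_mult, Cmod_inv, !Cmod_mult by (repeat apply Cmult_neq_0; assumption).
    fold m.
    assert (0 < m * m * Cmod w) by (repeat apply Rmult_lt_0_compat; lra).
    apply (Rmult_le_reg_r (m * m * Cmod w)); [assumption|].
    rewrite Rmult_assoc, Rinv_l, Rmult_1_r by lra.
    assert (e * (m * m * (m / 2)) <= e * (m * m * Cmod w)).
    { apply Rmult_le_compat_l; [lra|]. apply Rmult_le_compat_l; [|lra].
      apply Rmult_le_pos; lra. }
    replace (e * (m * m * (m / 2))) with (e * (m * m * m) / 2) in * by field.
    lra.
Qed.

Lemma cderiv_translate (f : C -> C) (z0 z l : C) :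
  cderiv f (z0 + z) l -> cderiv (fun w => f (z0 + w)%C) z l.
Proof.
  intros [_ H2]; split.
  - exists (Cmod l); split; [apply Cmod_ge_0|]; intros p; rewrite Cmod_mult; lra.
  - intros e He; destruct (H2 e He) as [d [Hd H]]; exists d; split; [exact Hd|].
    intros w Hw; specialize (H (z0 + w)%C).
    replace (z0 + w - (z0 + z))%C with (w - z)%C in H by ring.
    apply H; exact Hw.
Qed.

Lemma cderiv_continuous (f : C -> C) (z l : C) :
  cderiv f z l -> forall e, 0 < e -> exists d, 0 < d /\
    forall w, Cmod (w - z) < d -> Cmod (f w - f z) < e.
Proof.
  intros H e He; destruct (expands_lipschitz _ _ _ _ H) as (K & d & HK & Hd & HL).
  assert (HeK : 0 < e / K) by (apply Rdiv_lt_0_compat; lra).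
  exists (Rmin d (e / K)); split; [apply Rmin_pos; assumption|].
  intros w Hw; pose proof (Rmin_l d (e / K)); pose proof (Rmin_r d (e / K)).
  eapply Rle_lt_trans; [apply HL; lra|].
  replace e with (K * (e / K)) by (field; lra).
  apply Rmult_lt_compat_l; lra.
Qed.

Lemma is_derive_cderiv (f : C -> C) (z l : C) :
  is_derive (K := C_AbsRing) (V := C_NormedModule) f z l <-> cderiv f z l.
Proof.
  split.
  - intros [_ H]; specialize (H z (fun P HP => HP)); split.
    + exists (Cmod l); split; [apply Cmod_ge_0|]; intros p; rewrite Cmod_mult; lra.
    + intros e He; destruct (H (mkposreal e He)) as [d Hd]; exists d.
      split; [apply cond_pos|]; intros w Hw.
      rewrite (Cmult_comm l).
      exact (Hd w Hw).
  - intros [_ H]; split; [apply is_linear_scal_l|].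
    intros y Hy e.
    apply (is_filter_lim_locally_unique (V := AbsRing_NormedModule C_AbsRing)) in Hy; subst y.
    destruct (H e (cond_pos e)) as [d [Hd Hd']].
    exists (mkposreal d Hd); intros w Hw.
    specialize (Hd' w Hw); rewrite (Cmult_comm l) in Hd'; exact Hd'.
Qed.

Definition circle (r t : R) : C := (r * cos t, r * sin t).

Lemma Cmod_circle (r t : R) : 0 <= r -> Cmod (circle r t) = r.
Proof.
  intros Hr; unfold Cmod, circle; simpl.
  replace (_ + _) with (r * r) by
    (pose proof (sin2_cos2 t) as H; unfold Rsqr in H; nra).
  apply sqrt_square, Hr.
Qed.

Definition dist2 (p q : R) (v : R * R) : R := Rabs (fst v - p) + Rabs (snd v - q).

Lemma dist2_pos (p q : R) (v : R * R) : 0 <= dist2 p q v.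
Proof.
  unfold dist2; pose proof (Rabs_pos (fst v - p)); pose proof (Rabs_pos (snd v - q)); lra.
Qed.

Lemma expands_fst (p q : R) :
  expands (dist2 p q) (fun v => RtoC (fst v)) p (fun v => RtoC (fst v - p)).
Proof.
  split.
  - exists 1; split; [lra|]; intros v; rewrite Cmod_R; unfold dist2.
    pose proof (Rabs_pos (snd v - q)); lra.
  - intros e He; exists 1; split; [lra|]; intros v _; rewrite RtoC_minus.
    replace (fst v - p - (fst v - p))%C with (RtoC 0) by ring.
    rewrite Cmod_0; apply Rmult_le_pos; [lra|apply dist2_pos].
Qed.

Lemma derivable_pt_lim_expansion (g : R -> R) (x l : R) :
  derivable_pt_lim g x l -> forall e, 0 < e -> exists d, 0 < d /\
    forall y, Rabs (y - x) < d -> Rabs (g y - g x - l * (y - x)) <= e * Rabs (y - x).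
Proof.
  intros H e He; destruct (H e He) as [d Hd]; exists d; split; [apply cond_pos|].
  intros y Hy; destruct (Req_dec y x) as [->|Hn].
  - rewrite !Rminus_diag, Rmult_0_r, Rminus_0_r, Rabs_R0; lra.
  - specialize (Hd (y - x) ltac:(lra) Hy).
    replace (x + (y - x)) with y in Hd by ring.
    replace (g y - g x - l * (y - x)) with (((g y - g x) / (y - x) - l) * (y - x))
      by (field; lra).
    rewrite Rabs_mult; apply Rmult_le_compat_r; [apply Rabs_pos|lra].
Qed.

Lemma Cmod_le_abs (z : C) : Cmod z <= Rabs (fst z) + Rabs (snd z).
Proof.
  replace z with (RtoC (fst z) + Ci * RtoC (snd z))%C at 1
    by (apply injective_projections; simpl; ring).
  eapply Rle_trans; [apply Cmod_triangle|].
  rewrite Cmod_mult, Cmod_Ci, !Cmod_R; lra.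
Qed.

Lemma Cmod_abs_le (z : C) : Rabs (fst z) <= Cmod z /\ Rabs (snd z) <= Cmod z.
Proof.
  pose proof (Rmax_Cmod z) as H.
  pose proof (Rmax_l (Rabs (fst z)) (Rabs (snd z))).
  pose proof (Rmax_r (Rabs (fst z)) (Rabs (snd z))). lra.
Qed.

(** The coordinate [fst v] is carried along so that this expansion combines with [expands_fst] in
    the homotopy of [cauchy_Re]. *)
Lemma expands_circle (r p q : R) : 0 < r ->
  expands (dist2 p q) (fun v => circle r (snd v)) (circle r q)
    (fun v => Ci * circle r q * RtoC (snd v - q))%C.
Proof.
  intros Hr; split.
  - exists r; split; [lra|]; intros v.
    rewrite !Cmod_mult, Cmod_Ci, Cmod_circle, Cmod_R by lra.
    unfold dist2; pose proof (Rabs_pos (fst v - p)); nra.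
  - intros e He.
    assert (He2 : 0 < e / 2 / r) by (repeat apply Rdiv_lt_0_compat; lra).
    destruct (derivable_pt_lim_expansion _ _ _ (derivable_pt_lim_cos q) _ He2) as [d1 [Hd1 E1]].
    destruct (derivable_pt_lim_expansion _ _ _ (derivable_pt_lim_sin q) _ He2) as [d2 [Hd2 E2]].
    exists (Rmin d1 d2); split; [apply Rmin_pos; assumption|].
    intros [x y]; unfold dist2; simpl; intros Hv.
    pose proof (Rmin_l d1 d2); pose proof (Rmin_r d1 d2).
    pose proof (Rabs_pos (x - p)).
    specialize (E1 y ltac:(lra)); specialize (E2 y ltac:(lra)).
    eapply Rle_trans; [apply Cmod_le_abs|]; simpl.
    replace (r * cos y + - (r * cos q) + _) with (r * (cos y - cos q - - sin q * (y - q))) by ring.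
    replace (r * sin y + - (r * sin q) + _) with (r * (sin y - sin q - cos q * (y - q))) by ring.
    rewrite !Rabs_mult, Rabs_pos_eq by lra.
    apply (Rmult_le_compat_l r) in E1; [|lra]; apply (Rmult_le_compat_l r) in E2; [|lra].
    replace (r * (e / 2 / r * Rabs (y - q))) with (e / 2 * Rabs (y - q)) in * by (field; lra).
    nra.
Qed.

Lemma expands_has_gradient_Re (F : R * R -> C) (p q : R) (a b : C) :
  expands (dist2 p q) F (F (p, q)) (fun v => a * RtoC (fst v - p) + b * RtoC (snd v - q))%C ->
  has_gradient (fun x y => Re (F (x, y))) p q (Re a) (Re b).
Proof.
  intros [_ H] e He; destruct (H e He) as [d [Hd Hd']].
  exists (d / 2); split; [lra|]; intros x y Hx Hy.
  specialize (Hd' (x, y)); unfold dist2 in Hd'; simpl in Hd'.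
  eapply Rle_trans; [|apply Hd'; lra].
  eapply Rle_trans; [|apply (proj1 (Cmod_abs_le _))].
  right; f_equal; unfold Re; simpl; ring.
Qed.

(* Goursat's theorem on the contraction [z + t (circle r s - z)] of the circle to
   [z], with [t -> 0].  The factor [k] makes this cover imaginary parts as well. *)
Lemma cauchy_Re (f : C -> C) (r : R) (z k : C) :
  Cmod z < r -> (forall w, Cmod w <= r -> exists l, cderiv f w l) ->
  RInt (fun s => Re (k * ((f (circle r s) - f z) * (circle r s * / (circle r s - z)))))%C
    0 (2 * PI) = 0.
Proof.
  intros Hz Hf.
  pose proof PI_RGT_0 as HPI; pose proof (Cmod_ge_0 z) as Hz0.
  assert (Hr : 0 < r) by lra.
  set (E := circle r).
  assert (HE : forall s, Cmod (E s) = r) by (intros; apply Cmod_circle; lra).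
  assert (HEz : forall s, r - Cmod z <= Cmod (E s - z)).
  { intros s; rewrite <- (HE s); apply Cmod_minus_ge. }
  assert (HEz0 : forall s, (E s - z)%C <> 0).
  { intros s H; specialize (HEz s); rewrite H, Cmod_0 in HEz; lra. }
  set (g := fun v : R * R => (z + RtoC (fst v) * (E (snd v) - z))%C).
  set (D := fun v => (f (g v) - f z)%C).
  (* With w = g(x, y), the form X dx + Y dy is the pullback of -i k (f(w) - f(z)) / (w - z) dw: here
     w - z = x (E y - z) and dw = (E y - z) dx + x i (E y) dy. *)
  set (X := fun v : R * R => (k * (- Ci * (D v * / RtoC (fst v))))%C).
  set (Y := fun v : R * R => (k * (D v * (E (snd v) * / (E (snd v) - z))))%C).
  assert (Hgrad : forall p q, 0 < p <= 1 -> exists c u v,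
    has_gradient (fun x y => Re (X (x, y))) p q u c /\
    has_gradient (fun x y => Re (Y (x, y))) p q c v).
  { intros p q Hp.
    pose proof (dist2_pos p q) as Hn.
    assert (Hg : Cmod (g (p, q)) <= r).
    { unfold g; simpl.
      replace (z + p * (E q - z))%C with (RtoC (1 - p) * z + p * E q)%C
        by (rewrite RtoC_minus; ring).
      eapply Rle_trans; [apply Cmod_triangle|].
      rewrite !Cmod_mult, !Cmod_R, HE, !Rabs_pos_eq by lra; nra. }
    destruct (Hf _ Hg) as [l Hl].
    assert (Ep : RtoC p <> 0) by (intros H; apply RtoC_inj in H; lra).
    pose proof (expands_circle r p q Hr) as XE; fold (E q) in XE.
    assert (XEz : expands (dist2 p q) (fun v => E (snd v) - z)%C (E q - z)%C
      (fun v => Ci * E q * RtoC (snd v - q))%C).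
    { refine (expands_ext _ _ _ _ _ _ _ _ _ _
        (expands_plus _ _ _ _ _ _ _ XE (expands_const _ (- z)%C Hn)));
      intros; unfold E; simpl; ring. }
    assert (Xg : expands (dist2 p q) g (g (p, q))
      (fun v => (E q - z) * RtoC (fst v - p) + p * (Ci * E q) * RtoC (snd v - q))%C).
    { refine (expands_ext _ _ _ _ _ _ _ _ _ _
        (expands_plus _ _ _ _ _ _ _ (expands_const _ z Hn)
          (expands_mult _ _ _ _ _ _ _ Hn (expands_fst p q) XEz)));
      intros; unfold g; simpl; ring. }
    assert (XD : expands (dist2 p q) D (D (p, q))
      (fun v => l * ((E q - z) * RtoC (fst v - p) + p * (Ci * E q) * RtoC (snd v - q)))%C).
    { refine (expands_ext _ _ _ _ _ _ _ _ _ _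
        (expands_plus _ _ _ _ _ _ _ (expands_comp _ f _ _ _ _ Hn Xg Hl)
          (expands_const _ (- f z)%C Hn)));
      intros; unfold D; simpl; ring. }
    pose proof (expands_comp _ _ _ _ _ _ Hn (expands_fst p q) (cderiv_inv _ Ep)) as Xi.
    pose proof (expands_comp _ _ _ _ _ _ Hn XEz (cderiv_inv _ (HEz0 q))) as XEi.
    pose proof (expands_mult _ _ _ _ _ _ _ Hn (expands_const _ (k * - Ci)%C Hn)
      (expands_mult _ _ _ _ _ _ _ Hn XD Xi)) as XX.
    pose proof (expands_mult _ _ _ _ _ _ _ Hn (expands_const _ k Hn)
      (expands_mult _ _ _ _ _ _ _ Hn XD (expands_mult _ _ _ _ _ _ _ Hn XE XEi))) as XY.
    (* The common mixed derivative: the y-derivative of [X] is k (-i) (l p i E) / p, the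
       x-derivative of [Y] is k l (E - z) E / (E - z), and both equal k l E. *)
    exists (Re (k * (l * E q))),
      (Re (k * - Ci * (l * (E q - z) * / p - D (p, q) * / (p * p)))),
      (Re (k * (D (p, q) * (Ci * E q * / (E q - z) - E q * (/ ((E q - z) * (E q - z)) * (Ci * E q)))
         + l * p * (Ci * E q) * (E q * / (E q - z))))).
    assert (HCi : (Ci * Ci = - (1))%C) by (apply injective_projections; simpl; ring).
    split; apply expands_has_gradient_Re.
    - refine (expands_ext _ _ _ _ _ _ _ _ _ _ XX).
      + intros v; unfold X; ring.
      + unfold X; simpl; ring.
      + intros v.
        replace (k * (l * E q))%C with (k * - (Ci * Ci) * (l * E q))%C by (rewrite HCi; ring).
        field; exact Ep.
    - refine (expands_ext _ _ _ _ _ _ _ _ _ _ XY).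
      + intros v; unfold Y, E; simpl; ring.
      + unfold Y, E; simpl; ring.
      + intros v; fold (E q); field; apply HEz0. }
  assert (HXper : forall x, X (x, 0 + 2 * PI) = X (x, 0)).
  { intros x; unfold X, D, g, E, circle; simpl.
    rewrite Rplus_0_l, cos_2PI, sin_2PI, cos_0, sin_0; reflexivity. }
  (* The sides y = 0 and y = 2 PI carry the same values of [X], so Goursat makes the integral of [Y]
     independent of the contraction factor. The rectangle stops at [d > 0] because [X] contains
     1/x. *)
  assert (HG : forall d, 0 < d < 1 -> RInt (fun s => Re (Y (1, s))) 0 (2 * PI) =
     RInt (fun s => Re (Y (d, s))) 0 (2 * PI)).
  { intros d Hd.
    pose proof (goursat_rectangle (fun x y => Re (X (x, y))) (fun x y => Re (Y (x, y)))
      d 0 (1 - d) (2 * PI) ltac:(lra) ltac:(lra)) as G.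
    rewrite (RInt_ext (fun x => Re (X (x, 0 + 2 * PI))) (fun x => Re (X (x, 0)))) in G
      by (intros; rewrite HXper; reflexivity).
    replace (d + (1 - d)) with 1 in G by ring.
    rewrite Rplus_0_l in G.
    assert (G' : forall p q, d <= p <= 1 -> 0 <= q <= 2 * PI -> exists c u v,
      has_gradient (fun x y => Re (X (x, y))) p q u c /\
      has_gradient (fun x y => Re (Y (x, y))) p q c v)
      by (intros p q Hp Hq; apply Hgrad; lra).
    specialize (G G'); lra. }
  transitivity (RInt (fun s => Re (Y (1, s))) 0 (2 * PI)).
  { apply RInt_ext; intros s _; unfold Y, D, g; simpl.
    replace (z + 1 * (E s - z))%C with (E s) by ring; reflexivity. }
  set (I := RInt (fun s => Re (Y (1, s))) 0 (2 * PI)) in *.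
  destruct (Req_dec I 0) as [H0|H0]; [exact H0|exfalso].
  apply Rabs_pos_lt in H0.
  (* [B] bounds |k| |E / (E - z)| on the circle; the added 1 keeps it positive when [k] is 0. *)
  set (B := Cmod k * (r / (r - Cmod z)) + 1).
  pose proof (Cmod_ge_0 k) as Hk.
  assert (Hrz : 0 < r / (r - Cmod z)) by (apply Rdiv_lt_0_compat; lra).
  assert (HB : 0 < B)
    by (unfold B; pose proof (Rmult_le_pos _ _ Hk (Rlt_le _ _ Hrz)); lra).
  set (e := Rabs I / 2 / (2 * PI * B)).
  assert (He : 0 < e).
  { apply Rdiv_lt_0_compat; [lra|]; apply Rmult_lt_0_compat; lra. }
  destruct (Hf z ltac:(lra)) as [l Hl].
  destruct (cderiv_continuous _ _ _ Hl e He) as [d [Hd Hd']].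
  (* As |E s - z| <= 2 r, this [t] puts the contracted circle within d/2 of [z], where f - f(z) is
     smaller than [e]. *)
  set (t := Rmin (1 / 2) (d / (4 * r))).
  assert (Hdr : 0 < d / (4 * r)) by (apply Rdiv_lt_0_compat; lra).
  assert (Ht : 0 < t) by (apply Rmin_pos; lra).
  pose proof (Rmin_l (1 / 2) (d / (4 * r))) as T1; pose proof (Rmin_r (1 / 2) (d / (4 * r))) as T2.
  fold t in T1, T2.
  assert (HI : Rabs I <= (2 * PI - 0) * (e * B)).
  { rewrite (HG t ltac:(lra)).
    apply abs_RInt_le_const; [lra| |].
    - apply (ex_RInt_continuous (V := R_CompleteNormedModule)); intros q _.
      destruct (Hgrad t q ltac:(lra)) as (c & u & v & _ & Hc).
      apply continuous_eps; intros e' He'.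
      destruct (has_gradient_continuous _ _ _ _ _ Hc e' He') as [d1 [Hd1 Hd1']].
      exists d1; split; [exact Hd1|]; intros y Hy.
      apply Hd1'; [rewrite Rminus_diag, Rabs_R0; exact Hd1|exact Hy].
    - intros s _; eapply Rle_trans; [apply re_le_Cmod|].
      unfold Y; simpl; rewrite !Cmod_mult, Cmod_inv, HE by apply HEz0.
      assert (HD : Cmod (D (t, s)) <= e).
      { left; apply Hd'; unfold g; simpl.
        replace (z + t * (E s - z) - z)%C with (RtoC t * (E s - z))%C by ring.
        rewrite Cmod_mult, Cmod_R, Rabs_pos_eq by lra.
        assert (Cmod (E s - z) <= 2 * r).
        { unfold Cminus; eapply Rle_trans; [apply Cmod_triangle|]; rewrite Cmod_opp, HE; lra. }
        assert (t * Cmod (E s - z) <= d / (4 * r) * (2 * r))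
          by (apply Rmult_le_compat; try lra; apply Cmod_ge_0).
        replace (d / (4 * r) * (2 * r)) with (d / 2) in * by (field; lra). lra. }
      assert (HK : r * / Cmod (E s - z) <= r / (r - Cmod z)).
      { apply Rmult_le_compat_l; [lra|]; apply Rinv_le_contravar; [lra|apply HEz]. }
      pose proof (Cmod_ge_0 (D (t, s))).
      assert (0 <= r * / Cmod (E s - z)).
      { apply Rmult_le_pos; [lra|]; left; apply Rinv_0_lt_compat.
        specialize (HEz s); lra. }
      assert (Cmod (D (t, s)) * (r * / Cmod (E s - z)) <= e * (r / (r - Cmod z)))
        by (apply Rmult_le_compat; assumption).
      assert (Cmod k * (Cmod (D (t, s)) * (r * / Cmod (E s - z))) <=
        Cmod k * (e * (r / (r - Cmod z)))) by (apply Rmult_le_compat_l; assumption).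
      unfold B; nra. }
  assert ((2 * PI - 0) * (e * B) = Rabs I / 2) by (unfold e; field; lra).
  lra.
Qed.

(** * Second-order Taylor expansion *)

Definition differentiable (h : R -> C) : Prop :=
  forall t, exists L, expands (fun s => Rabs (s - t)) h (h t) L.

Lemma differentiable_const (c : C) : differentiable (fun _ => c).
Proof. intros t; eexists; apply expands_const; intros; apply Rabs_pos. Qed.

Lemma differentiable_plus (g h : R -> C) : differentiable g -> differentiable h -> differentiable (fun s => g s + h s)%C.
Proof.
  intros Hg Hh t; destruct (Hg t) as [L HL]; destruct (Hh t) as [M HM].
  eexists; apply expands_plus; eassumption.
Qed.

Lemma differentiable_mult (g h : R -> C) : differentiable g -> differentiable h -> differentiable (fun s => g s * h s)%C.
Proof.
  intros Hg Hh t; destruct (Hg t) as [L HL]; destruct (Hh t) as [M HM].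
  eexists; apply expands_mult; try eassumption; intros; apply Rabs_pos.
Qed.

Lemma differentiable_comp (f : C -> C) (h : R -> C) :
  differentiable h -> (forall t, exists l, cderiv f (h t) l) -> differentiable (fun s => f (h s)).
Proof.
  intros Hh Hf t; destruct (Hh t) as [L HL]; destruct (Hf t) as [l Hl].
  eexists; apply expands_comp; try eassumption; intros; apply Rabs_pos.
Qed.

Lemma differentiable_inv (h : R -> C) : differentiable h -> (forall t, h t <> 0) -> differentiable (fun s => / h s)%C.
Proof.
  intros Hh H0; apply differentiable_comp; [exact Hh|].
  intros t; eexists; apply cderiv_inv, H0.
Qed.

Lemma differentiable_circle (r : R) : 0 < r -> differentiable (circle r).
Proof.
  intros Hr t; destruct (expands_circle r 0 t Hr) as [[K [HK H1]] H2].
  exists (fun s => Ci * circle r t * RtoC (s - t))%C.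
  assert (Hd : forall s, dist2 0 t (0, s) = Rabs (s - t)).
  { intros s; unfold dist2; simpl; rewrite Rminus_0_r, Rabs_R0; ring. }
  split.
  - exists K; split; [exact HK|]; intros s; rewrite <- Hd; apply (H1 (0, s)).
  - intros e He; destruct (H2 e He) as [d [Hdp H]]; exists d; split; [exact Hdp|].
    intros s; rewrite <- Hd; apply (H (0, s)).
Qed.

Lemma differentiable_eps (h : R -> C) : differentiable h -> forall t e, 0 < e ->
  exists d, 0 < d /\ forall s, Rabs (s - t) < d -> Cmod (h s - h t) < e.
Proof.
  intros Hh t e He; destruct (Hh t) as [L HL].
  destruct (expands_lipschitz _ _ _ _ HL) as (K & d & HK & Hd & H).
  assert (HeK : 0 < e / K) by (apply Rdiv_lt_0_compat; lra).
  exists (Rmin d (e / K)); split; [apply Rmin_pos; assumption|].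
  intros s Hs; pose proof (Rmin_l d (e / K)); pose proof (Rmin_r d (e / K)).
  eapply Rle_lt_trans; [apply H; lra|].
  replace e with (K * (e / K)) by (field; lra).
  apply Rmult_lt_compat_l; lra.
Qed.

Lemma differentiable_ex_RInt_Re (h : R -> C) (a b : R) :
  differentiable h -> ex_RInt (fun s => Re (h s)) a b.
Proof.
  intros Hh; apply (ex_RInt_continuous (V := R_CompleteNormedModule)); intros t _.
  apply continuous_eps; intros e He; destruct (differentiable_eps h Hh t e He) as [d [Hd H]].
  exists d; split; [exact Hd|]; intros s Hs.
  eapply Rle_lt_trans; [|apply (H s Hs)].
  exact (proj1 (Cmod_abs_le (h s - h t))).
Qed.

Lemma differentiable_ex_RInt_Im (h : R -> C) (a b : R) :
  differentiable h -> ex_RInt (fun s => Im (h s)) a b.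
Proof.
  intros Hh; apply (ex_RInt_ext (fun s => Re ((- Ci) * h s)%C)).
  { intros s _; unfold Re, Im; simpl; ring. }
  apply differentiable_ex_RInt_Re, (differentiable_mult (fun _ => - Ci)%C); [apply differentiable_const|exact Hh].
Qed.

(** * Complex integrals over one turn of the circle *)

Definition Cint (h : R -> C) : C :=
  (RInt (fun s => Re (h s)) 0 (2 * PI), RInt (fun s => Im (h s)) 0 (2 * PI)).

Lemma Cint_ext (g h : R -> C) : (forall s, g s = h s) -> Cint g = Cint h.
Proof.
  intros H; unfold Cint; f_equal; apply RInt_ext; intros s _; rewrite H; reflexivity.
Qed.

Lemma Cint_plus (g h : R -> C) : differentiable g -> differentiable h ->
  Cint (fun s => g s + h s)%C = (Cint g + Cint h)%C.
Proof.
  intros Hg Hh; unfold Cint, Cplus; simpl; f_equal;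
  [ rewrite <- (RInt_plus (V := R_CompleteNormedModule)) by (apply differentiable_ex_RInt_Re; assumption)
  | rewrite <- (RInt_plus (V := R_CompleteNormedModule)) by (apply differentiable_ex_RInt_Im; assumption) ];
  reflexivity.
Qed.

Lemma Cint_scal (k : C) (h : R -> C) : differentiable h -> Cint (fun s => k * h s)%C = (k * Cint h)%C.
Proof.
  intros Hh; unfold Cint, Cmult; simpl.
  pose proof (differentiable_ex_RInt_Re h 0 (2 * PI) Hh) as HR.
  pose proof (differentiable_ex_RInt_Im h 0 (2 * PI) Hh) as HI.
  assert (Hsc : forall (a b : R) (u v : R -> R), ex_RInt u 0 (2 * PI) -> ex_RInt v 0 (2 * PI) ->
    RInt (fun s => a * u s + b * v s) 0 (2 * PI) =
    a * RInt u 0 (2 * PI) + b * RInt v 0 (2 * PI)).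
  { intros a b u v Hu Hv.
    rewrite (RInt_plus (V := R_CompleteNormedModule) (fun s => a * u s) (fun s => b * v s));
      [|apply (ex_RInt_scal (V := R_NormedModule)); assumption
       |apply (ex_RInt_scal (V := R_NormedModule)); assumption].
    exact (f_equal2 Rplus (RInt_scal (V := R_CompleteNormedModule) u 0 (2 * PI) a Hu)
      (RInt_scal (V := R_CompleteNormedModule) v 0 (2 * PI) b Hv)). }
  f_equal.
  - rewrite (RInt_ext _ (fun s => fst k * Re (h s) + - snd k * Im (h s)))
      by (intros; unfold Re, Im; simpl; ring).
    rewrite Hsc by assumption;
    match goal with |- @eq _ ?x ?y => change (@eq R x y) end; ring.
  - rewrite (RInt_ext _ (fun s => fst k * Im (h s) + snd k * Re (h s)))
      by (intros; unfold Re, Im; simpl; ring).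
    rewrite Hsc by assumption;
    match goal with |- @eq _ ?x ?y => change (@eq R x y) end; ring.
Qed.

(** Real and imaginary parts are bounded separately, which loses a factor 2 against 2 PI M; the
    Taylor remainder only requires some finite constant. *)
Lemma Cint_bound (h : R -> C) (M : R) :
  differentiable h -> (forall s, 0 <= s <= 2 * PI -> Cmod (h s) <= M) -> Cmod (Cint h) <= 4 * PI * M.
Proof.
  intros Hh HM; pose proof PI_RGT_0.
  eapply Rle_trans; [apply Cmod_le_abs|]; unfold Cint; simpl.
  assert (Rabs (RInt (fun s => Re (h s)) 0 (2 * PI)) <= (2 * PI - 0) * M).
  { apply abs_RInt_le_const; [lra|apply differentiable_ex_RInt_Re, Hh|].
    intros s Hs; eapply Rle_trans; [apply Cmod_abs_le|exact (HM s Hs)]. }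
  assert (Rabs (RInt (fun s => Im (h s)) 0 (2 * PI)) <= (2 * PI - 0) * M).
  { apply abs_RInt_le_const; [lra|apply differentiable_ex_RInt_Im, Hh|].
    intros s Hs; eapply Rle_trans; [apply Cmod_abs_le|exact (HM s Hs)]. }
  lra.
Qed.

Lemma Cint_const (c : C) : Cint (fun _ => c) = (RtoC (2 * PI) * c)%C.
Proof.
  unfold Cint; rewrite !RInt_const.
  apply injective_projections; simpl; unfold scal; simpl; unfold mult; simpl;
  unfold Re, Im; ring.
Qed.

(** The integrand is e^(-i a s). The frequencies 1 and 2 are those of 1/E and 1/E^2 in the expanded
    Cauchy kernel. *)
Lemma Cint_circle_neg (a : R) : a = 1 \/ a = 2 ->
  Cint (fun s => (cos (a * s), - sin (a * s))) = RtoC 0.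
Proof.
  intros Ha; assert (Ha0 : a <> 0) by (destruct Ha; lra).
  assert (Hs : sin (a * (2 * PI)) = 0).
  { destruct Ha as [-> | ->]; [rewrite Rmult_1_l; apply sin_2PI|].
    rewrite sin_2a, sin_2PI; ring. }
  assert (Hc : cos (a * (2 * PI)) = 1).
  { destruct Ha as [-> | ->]; [rewrite Rmult_1_l; apply cos_2PI|].
    rewrite cos_2a, sin_2PI, cos_2PI; ring. }
  unfold Cint, RtoC; simpl; f_equal; apply is_RInt_unique.
  - replace 0 with (minus (sin (a * (2 * PI)) / a) (sin (a * 0) / a)) at 2.
    2: { rewrite Hs, Rmult_0_r, sin_0; unfold minus, plus, opp; simpl; field; exact Ha0. }
    apply (is_RInt_derive (V := R_CompleteNormedModule) (fun s => sin (a * s) / a)).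
    + intros x _; auto_derive; [exact I|]; field; exact Ha0.
    + intros x _; apply (ex_derive_continuous (K := R_AbsRing) (V := R_NormedModule)).
      auto_derive; exact I.
  - replace 0 with (minus (cos (a * (2 * PI)) / a) (cos (a * 0) / a)) at 2.
    2: { rewrite Hc, Rmult_0_r, cos_0; unfold minus, plus, opp; simpl; field; exact Ha0. }
    apply (is_RInt_derive (V := R_CompleteNormedModule) (fun s => cos (a * s) / a)).
    + intros x _; auto_derive; [exact I|]; field; exact Ha0.
    + intros x _; apply (ex_derive_continuous (K := R_AbsRing) (V := R_NormedModule)).
      auto_derive; exact I.
Qed.

Lemma circle_nonzero (r s : R) : 0 < r -> circle r s <> RtoC 0.
Proof.
  intros Hr H; pose proof (Cmod_circle r s ltac:(lra)) as E; rewrite H, Cmod_0 in E; lra.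
Qed.

Lemma Cinv_circle (r s : R) : 0 < r -> (/ circle r s = RtoC (/ r)%R * (cos s, (- sin s)%R))%C.
Proof.
  intros Hr.
  assert (H : (circle r s * (RtoC (/ r)%R * (cos s, (- sin s)%R)) = 1)%C).
  { pose proof (sin2_cos2 s) as H; unfold Rsqr in H.
    apply injective_projections; simpl; field_simplify; try lra. }
  rewrite <- (Cmult_1_r (/ _)), <- H; field; apply circle_nonzero, Hr.
Qed.

Lemma Cint_inv_circle (r : R) : 0 < r -> Cint (fun s => / circle r s)%C = RtoC 0.
Proof.
  intros Hr.
  rewrite (Cint_ext _ (fun s => RtoC (/ r)%R * (cos (1 * s)%R, (- sin (1 * s)%R)%R))%C)
    by (intros s; rewrite Cinv_circle, !Rmult_1_l by exact Hr; reflexivity).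
  rewrite Cint_scal, Cint_circle_neg; [ring|left; reflexivity|].
  (* The conjugate curve (cos s, - sin s) is r / circle r s, so it inherits differentiability from
     the inverse of the circle. *)
  intros t; destruct (differentiable_mult (fun _ => RtoC r) (fun s => / circle r s)%C) with (t := t)
    as [L HL].
  { apply differentiable_const. }
  { apply differentiable_inv; [apply differentiable_circle, Hr|]; intros; apply circle_nonzero, Hr. }
  exists L; revert HL; apply expands_ext; auto; intros; rewrite Cinv_circle by exact Hr;
  rewrite ?Rmult_1_l; apply injective_projections; simpl; field; lra.
Qed.

Lemma Cint_inv_circle2 (r : R) : 0 < r -> Cint (fun s => / circle r s * / circle r s)%C = RtoC 0.
Proof.
  intros Hr.
  assert (HE : forall s, (/ circle r s * / circle r s =
    RtoC (/ r * / r)%R * (cos (2 * s)%R, (- sin (2 * s)%R)%R))%C).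
  { intros s; rewrite Cinv_circle, cos_2a, sin_2a by exact Hr.
    apply injective_projections; simpl; ring. }
  rewrite (Cint_ext _ _ HE).
  rewrite Cint_scal, Cint_circle_neg; [ring|right; reflexivity|].
  intros t; destruct (differentiable_mult (fun _ => RtoC (r * r)) (fun s => / circle r s * / circle r s)%C)
    with (t := t) as [L HL].
  { apply differentiable_const. }
  { apply differentiable_mult; apply differentiable_inv; try (apply differentiable_circle, Hr);
    intros; apply circle_nonzero, Hr. }
  exists L; revert HL; apply expands_ext; auto; intros; rewrite HE;
  apply injective_projections; simpl; field; lra.
Qed.

(** The factor k = 1 gives the real part and k = - i the imaginary part, since Re (- i w) = Im w. *)
Lemma cauchy_Cint (f : C -> C) (r : R) (z : C) :
  Cmod z < r -> (forall w, Cmod w <= r -> exists l, cderiv f w l) ->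
  Cint (fun s => (f (circle r s) - f z) * (circle r s * / (circle r s - z)))%C = RtoC 0.
Proof.
  intros Hz Hf; unfold Cint, RtoC; f_equal.
  - refine (eq_trans _ (cauchy_Re f r z 1 Hz Hf)); apply RInt_ext; intros s _.
    rewrite Cmult_1_l; reflexivity.
  - refine (eq_trans _ (cauchy_Re f r z (- Ci) Hz Hf)); apply RInt_ext; intros s _.
    unfold Re, Im; simpl; ring.
Qed.

Lemma differentiable_bounded (h : R -> C) : differentiable h ->
  exists M, 0 <= M /\ forall s, 0 <= s <= 2 * PI -> Cmod (h s) <= M.
Proof.
  intros Hh; pose proof PI_RGT_0.
  destruct (continuity_ab_maj (fun s => Cmod (h s)) 0 (2 * PI)) as [m [Hm _]]; [lra| |].
  - intros t _; apply continuity_pt_filterlim, continuous_eps; intros e He.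
    destruct (differentiable_eps h Hh t e He) as [d [Hd H']]; exists d; split; [exact Hd|].
    intros s Hs; specialize (H' s Hs).
    pose proof (Cmod_minus_ge (h s) (h t)); pose proof (Cmod_minus_ge (h t) (h s)) as H2.
    rewrite Cmod_minus_sym in H2; apply Rabs_def1; lra.
  - exists (Cmod (h m)); split; [apply Cmod_ge_0|exact Hm].
Qed.

(** The Cauchy kernel satisfies E / (E - z) = 1 + z/E + z^2/E^2 + (z^3/E^3) E / (E - z). Integrated
    against f(E) - f(z), the first three terms produce the quadratic polynomial, and the last one,
    bounded for |z| < r/2, is the cubic error. *)
Lemma taylor2_at_0 (f : C -> C) (r : R) : 0 < r ->
  (forall w, Cmod w <= r -> exists l, cderiv f w l) ->
  exists c1 c2 M d, 0 <= M /\ 0 < d /\ forall z, Cmod z < d ->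
    Cmod (f z - f 0 - c1 * z - c2 * (z * z)) <= M * (Cmod z * (Cmod z * Cmod z)).
Proof.
  intros Hr Hf; pose proof PI_RGT_0 as HPI.
  set (E := circle r).
  assert (HE : forall s, Cmod (E s) = r) by (intros; apply Cmod_circle; lra).
  assert (HE0 : forall s, E s <> RtoC 0) by (intros; apply circle_nonzero, Hr).
  assert (SE : differentiable E) by (apply differentiable_circle, Hr).
  assert (Si : differentiable (fun s => / E s)%C) by (apply differentiable_inv; assumption).
  assert (Sf : differentiable (fun s => f (E s))).
  { apply differentiable_comp; [exact SE|]; intros t; apply Hf; rewrite HE; lra. }
  destruct (differentiable_bounded _ Sf) as [M0 [HM0 HM]].
  destruct (Hf 0) as [l Hl]; [rewrite Cmod_0; lra|].
  destruct (cderiv_continuous _ _ _ Hl 1 Rlt_0_1) as [d [Hd Hfd]].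
  set (k := (/ RtoC (2 * PI))%C).
  assert (Hpi : RtoC (2 * PI) <> 0) by (intros H; apply RtoC_inj in H; lra).
  set (a0 := Cint (fun s => f (E s))).
  set (a1 := Cint (fun s => f (E s) * / E s)%C).
  set (a2 := Cint (fun s => f (E s) * (/ E s * / E s))%C).
  (* [M0] bounds [f] on the circle, [Cmod (f 0) + 1] bounds [f z] near 0, the cube of 1/r bounds
     1/E^3, and 2 bounds |E / (E - z)| for |z| <= r/2. *)
  set (B := (M0 + (Cmod (f 0) + 1)) * (/ r * (/ r * / r) * 2)).
  assert (Hmain : forall z, Cmod z < Rmin d (r / 2) ->
    Cmod (f z - k * a0 - k * a1 * z - k * a2 * (z * z)) <=
      2 * B * (Cmod z * (Cmod z * Cmod z))).
  { intros z Hz; pose proof (Rmin_l d (r / 2)); pose proof (Rmin_r d (r / 2)).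
    pose proof (cauchy_Cint f r z ltac:(lra) Hf) as HC; fold E in HC.
    assert (HEz : forall s, r / 2 <= Cmod (E s - z)).
    { intros s; pose proof (Cmod_minus_ge (E s) z) as H1; rewrite HE in H1; lra. }
    assert (HEz0 : forall s, (E s - z)%C <> RtoC 0).
    { intros s H1; specialize (HEz s); rewrite H1, Cmod_0 in HEz; lra. }
    set (W := fun s => ((f (E s) + - f z) * ((/ E s * (/ E s * / E s)) * (E s * / (E s + - z))))%C).
    assert (SW : differentiable W).
    { unfold W; apply differentiable_mult; [apply differentiable_plus; [exact Sf|apply differentiable_const]|].
      repeat apply differentiable_mult; try assumption.
      apply differentiable_inv; [apply differentiable_plus; [exact SE|apply differentiable_const]|exact HEz0]. }
    assert (HW : Cmod (Cint W) <= 4 * PI * B).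
    { apply Cint_bound; [exact SW|]; intros s Hs; unfold W, B.
      change (E s + - z)%C with (E s - z)%C.
      rewrite !Cmod_mult, !Cmod_inv, HE by (apply HE0 || apply HEz0).
      assert (Hfz : Cmod (f z) <= Cmod (f 0) + 1).
      { pose proof (Cmod_minus_ge (f z) (f 0)) as H1.
        specialize (Hfd z); replace (z - 0)%C with z in Hfd by ring.
        specialize (Hfd ltac:(lra)); lra. }
      assert (0 < / r) by (apply Rinv_0_lt_compat; lra).
      apply Rmult_le_compat; [apply Cmod_ge_0| | |].
      - repeat apply Rmult_le_pos; try lra.
        left; apply Rinv_0_lt_compat; specialize (HEz s); lra.
      - eapply Rle_trans; [apply Cmod_triangle|]; rewrite Cmod_opp.
        specialize (HM s Hs); lra.
      - apply Rmult_le_compat_l; [repeat apply Rmult_le_pos; lra|].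
        replace 2 with (r * / (r / 2)) by (field; lra).
        apply Rmult_le_compat_l; [lra|]; apply Rinv_le_contravar; [lra|apply HEz]. }
    (* Besides 2 PI, the terms multiplying [f z] are the integrals of 1/E and 1/E^2, which vanish;
       hence only [f z * 2 PI] is left of them. *)
    assert (HS : (a0 + (z * a1 + (z * z) * a2) + - f z * RtoC (2 * PI)
      + (z * (z * z)) * Cint W = 0)%C).
    { rewrite <- HC.
      rewrite (Cint_ext (fun s => (f (E s) - f z) * (E s * / (E s - z)))%C
        (fun s => (f (E s) + (z * (f (E s) * / E s) + (z * z) * (f (E s) * (/ E s * / E s))))
          + (- f z * (1 + (z * / E s + (z * z) * (/ E s * / E s))) + (z * (z * z)) * W s))%C).
      2: { intros s; unfold W; specialize (HE0 s); specialize (HEz0 s).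
           change (E s + - z)%C with (E s - z)%C; field; auto. }
      assert (S1 : differentiable (fun s => f (E s) * / E s)%C) by (apply differentiable_mult; assumption).
      assert (S2 : differentiable (fun s => / E s * / E s)%C) by (apply differentiable_mult; assumption).
      assert (S3 : differentiable (fun s => f (E s) * (/ E s * / E s))%C) by (apply differentiable_mult; assumption).
      assert (Sc : forall c h, differentiable h -> differentiable (fun s => c * h s)%C).
      { intros c h Hh; apply differentiable_mult; [apply differentiable_const|exact Hh]. }
      assert (S5 : differentiable (fun s => 1 + (z * / E s + z * z * (/ E s * / E s)))%C).
      { apply differentiable_plus; [apply differentiable_const|]; apply differentiable_plus; apply Sc; assumption. }
      rewrite Cint_plus.
      - rewrite Cint_plus, Cint_plus, Cint_scal, Cint_scal;
          try assumption; try (apply Sc; assumption);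
          [|apply differentiable_plus; apply Sc; assumption].
        rewrite Cint_plus, Cint_scal, Cint_scal;
          try assumption; try (apply Sc; assumption).
        rewrite Cint_plus, Cint_plus, Cint_scal, Cint_scal, Cint_const;
          try assumption; try apply differentiable_const; try (apply Sc; assumption);
          [|apply differentiable_plus; apply Sc; assumption].
        rewrite (Cint_inv_circle r Hr : Cint (fun s => / E s)%C = 0).
        rewrite (Cint_inv_circle2 r Hr : Cint (fun s => / E s * / E s)%C = 0).
        unfold a0, a1, a2; ring.
      - apply differentiable_plus; [exact Sf|]; apply differentiable_plus; apply Sc; assumption.
      - apply differentiable_plus; apply Sc; assumption. }
    replace (f z - k * a0 - k * a1 * z - k * a2 * (z * z))%C with
      (k * ((z * (z * z)) * Cint W))%C.
    2: { replace ((z * (z * z)) * Cint W)%C with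
           (f z * RtoC (2 * PI) - a0 - (z * a1 + (z * z) * a2))%C.
         - unfold k; field; exact Hpi.
         - rewrite <- (Cplus_0_r (f z * _ - _ - _)), <- HS; ring. }
    unfold k; rewrite !Cmod_mult, Cmod_inv, Cmod_R, Rabs_pos_eq by (lra || exact Hpi).
    pose proof (Cmod_ge_0 z).
    assert (0 <= Cmod z * (Cmod z * Cmod z)) by (repeat apply Rmult_le_pos; assumption).
    replace (2 * B * (Cmod z * (Cmod z * Cmod z))) with
      (/ (2 * PI) * (Cmod z * (Cmod z * Cmod z) * (4 * PI * B))) by (field; lra).
    apply Rmult_le_compat_l; [left; apply Rinv_0_lt_compat; lra|].
    apply Rmult_le_compat_l; assumption. }
  assert (Hd' : 0 < Rmin d (r / 2)) by (apply Rmin_pos; lra).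
  (* The constant term is identified by taking z = 0 in the estimate itself. *)
  assert (Hf0 : f 0 = (k * a0)%C).
  { specialize (Hmain 0); rewrite Cmod_0 in Hmain; specialize (Hmain Hd').
    rewrite !Rmult_0_l, Rmult_0_r in Hmain.
    apply Ceq_minus, Cmod_eq_0, Rle_antisym; [|apply Cmod_ge_0].
    eapply Rle_trans; [|exact Hmain]; right; f_equal; ring. }
  exists (k * a1)%C, (k * a2)%C, (2 * B), (Rmin d (r / 2)).
  rewrite Hf0; repeat split; [|exact Hd'|exact Hmain].
  unfold B; assert (0 < / r) by (apply Rinv_0_lt_compat; lra).
  pose proof (Cmod_ge_0 (f 0)).
  repeat apply Rmult_le_pos; lra.
Qed.

Lemma taylor2 (f : C -> C) (z0 : C) (r : R) : 0 < r ->
  (forall w, Cmod (w - z0) < r -> exists l, cderiv f w l) ->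
  exists c1 c2 M d, 0 <= M /\ 0 < d /\ forall h, Cmod h < d ->
    Cmod (f (z0 + h)%C - f z0 - c1 * h - c2 * (h * h)) <= M * (Cmod h * (Cmod h * Cmod h)).
Proof.
  intros Hr Hf.
  destruct (taylor2_at_0 (fun w => f (z0 + w)%C) (r / 2)) as (c1 & c2 & M & d & HM & Hd & H);
    [lra| |].
  - intros w Hw; destruct (Hf (z0 + w)%C) as [l Hl].
    { replace (z0 + w - z0)%C with w by ring; lra. }
    exists l; apply cderiv_translate, Hl.
  - exists c1, c2, M, d; repeat split; try assumption.
    rewrite Cplus_0_r in H; exact H.
Qed.

(** * Subharmonic functions and circle means *)

Definition holomorphic (f : C -> C) : Prop :=
  forall z, Cmod z < 1 -> exists l, cderiv f z l.

Definition disc_continuous (u : C -> R) : Prop :=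
  forall z, Cmod z < 1 -> forall e, 0 < e -> exists d, 0 < d /\
    forall w, Cmod (w - z) < d -> Rabs (u w - u z) < e.

(* An error of order [|h|^3] is harmless: in the maximum principle it is beaten
   by the term [e |z|^2], which gains [4 e |h|^2] over the four points. *)
Definition submean (u : C -> R) : Prop :=
  forall z, Cmod z < 1 -> exists M d, 0 <= M /\ 0 < d /\ forall h, Cmod h < d ->
    4 * u z <= u (z + h)%C + u (z + - h)%C + u (z + Ci * h)%C + u (z + - (Ci * h))%C
      + M * (Cmod h * (Cmod h * Cmod h)).

Lemma holomorphic_taylor2 (f : C -> C) (z : C) : holomorphic f -> Cmod z < 1 ->
  exists c1 c2 M d, 0 <= M /\ 0 < d /\ forall h, Cmod h < d ->
    Cmod (f (z + h)%C - f z - c1 * h - c2 * (h * h)) <= M * (Cmod h * (Cmod h * Cmod h)).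
Proof.
  intros Hf Hz; apply (taylor2 f z (1 - Cmod z)); [lra|].
  intros w Hw; apply Hf.
  pose proof (Cmod_minus_ge w z); lra.
Qed.

Lemma Cmod_Ci_mult (h : C) : Cmod (Ci * h) = Cmod h.
Proof. rewrite Cmod_mult, Cmod_Ci; ring. Qed.

(** Over h, -h, ih, -ih the linear Taylor terms cancel in opposite pairs and the quadratic ones
    because i^2 = -1. So 4 f(z) is the sum of the four values up to 4 M |h|^3, and the triangle
    inequality finishes. *)
Lemma submean_Cmod (f : C -> C) : holomorphic f -> submean (fun z => Cmod (f z)).
Proof.
  intros Hf z Hz; destruct (holomorphic_taylor2 f z Hf Hz) as (c1 & c2 & M & d & HM & Hd & H).
  exists (4 * M), d; repeat split; [lra|exact Hd|]; intros h Hh.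
  pose proof (H h Hh) as E1; pose proof (H (- h)%C ltac:(rewrite Cmod_opp; exact Hh)) as E2.
  pose proof (H (Ci * h)%C ltac:(rewrite Cmod_Ci_mult; exact Hh)) as E3.
  pose proof (H (- (Ci * h))%C ltac:(rewrite Cmod_opp, Cmod_Ci_mult; exact Hh)) as E4.
  rewrite !Cmod_opp in E2, E4; rewrite !Cmod_Ci_mult in E3, E4.
  set (e1 := (f (z + h) - _ - _ - _)%C) in E1; set (e2 := (f (z + - h) - _ - _ - _)%C) in E2.
  set (e3 := (f (z + Ci * h) - _ - _ - _)%C) in E3.
  set (e4 := (f (z + - (Ci * h)) - _ - _ - _)%C) in E4.
  assert (Hsum : (RtoC 4 * f z = f (z + h) + (f (z + - h) + (f (z + Ci * h) + f (z + - (Ci * h))))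
    + - (e1 + (e2 + (e3 + e4))))%C).
  { assert (HCi : (Ci * Ci = - (1))%C) by (apply injective_projections; simpl; ring).
    unfold e1, e2, e3, e4.
    replace (Ci * h * (Ci * h))%C with (Ci * Ci * (h * h))%C by ring.
    replace (- (Ci * h) * - (Ci * h))%C with (Ci * Ci * (h * h))%C by ring.
    rewrite HCi; ring. }
  assert (H4 : 4 * Cmod (f z) = Cmod (RtoC 4 * f z)).
  { rewrite Cmod_mult, Cmod_R, Rabs_pos_eq by lra; reflexivity. }
  rewrite H4, Hsum.
  eapply Rle_trans; [apply Cmod_triangle|]; rewrite Cmod_opp.
  pose proof (Cmod_triangle (f (z + h)%C) (f (z + - h) + (f (z + Ci * h) + f (z + - (Ci * h))))%C).
  pose proof (Cmod_triangle (f (z + - h)%C) (f (z + Ci * h) + f (z + - (Ci * h)))%C).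
  pose proof (Cmod_triangle (f (z + Ci * h)%C) (f (z + - (Ci * h)))%C).
  pose proof (Cmod_triangle e1 (e2 + (e3 + e4))); pose proof (Cmod_triangle e2 (e3 + e4)).
  pose proof (Cmod_triangle e3 e4). lra.
Qed.

Lemma disc_continuous_Cmod (f : C -> C) : holomorphic f -> disc_continuous (fun z => Cmod (f z)).
Proof.
  intros Hf z Hz e He; destruct (Hf z Hz) as [l Hl].
  destruct (cderiv_continuous _ _ _ Hl e He) as [d [Hd H]]; exists d; split; [exact Hd|].
  intros w Hw; specialize (H w Hw).
  pose proof (Cmod_minus_ge (f w) (f z)); pose proof (Cmod_minus_ge (f z) (f w)) as H2.
  rewrite Cmod_minus_sym in H2; apply Rabs_def1; lra.
Qed.

(* The real part of the principal square root. *)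
Definition re_sqrt (w : C) : R := sqrt ((Cmod w + Re w) / 2).

(** The half-angle identity (|g|^2 + Re g^2) / 2 = (Re g)^2. Both roots g and -g give the same
    value, the larger of their real parts. *)
Lemma re_sqrt_square (g : C) : re_sqrt (g * g) = Rabs (Re g).
Proof.
  unfold re_sqrt; rewrite Cmod_mult.
  replace (Cmod g * Cmod g) with (Re g ^ 2 + Im g ^ 2) by (rewrite <- Cmod2_alt; ring).
  rewrite re_mult.
  replace (_ / 2) with (Rsqr (Re g)) by (unfold Rsqr; field).
  apply sqrt_Rsqr_abs.
Qed.

Lemma Csqrt_exists (w : C) : exists g, (g * g)%C = w /\ Re g = re_sqrt w.
Proof.
  destruct (Cmod_abs_le w) as [Hre _]; apply Rabs_le_between in Hre.
  set (a := sqrt ((Cmod w + Re w) / 2)); set (b := sqrt ((Cmod w - Re w) / 2)).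
  assert (Ha : a * a = (Cmod w + Re w) / 2) by (apply sqrt_sqrt; unfold Re; lra).
  assert (Hb : b * b = (Cmod w - Re w) / 2) by (apply sqrt_sqrt; unfold Re; lra).
  assert (Hab : a * b = Rabs (Im w) / 2).
  { unfold a, b; rewrite <- sqrt_mult by (unfold Re; lra).
    replace (_ * _) with (Rsqr (Im w / 2)).
    - rewrite sqrt_Rsqr_abs; unfold Rdiv; rewrite Rabs_mult, (Rabs_pos_eq (/ 2)) by lra.
      reflexivity.
    - pose proof (Cmod2_alt w); unfold Rsqr; nra. }
  unfold re_sqrt; fold a.
  (* Only |Im w| = 2 a b is known, so the sign of the imaginary part of the root has to follow that
     of [Im w]. *)
  destruct (Rle_dec 0 (Im w)) as [Hi|Hi].
  - exists (a, b); split; [|reflexivity].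
    rewrite Rabs_pos_eq in Hab by exact Hi.
    apply injective_projections; simpl; unfold Re, Im in *; lra.
  - exists (a, - b); split; [|reflexivity].
    rewrite Rabs_left in Hab by lra.
    apply injective_projections; simpl; unfold Re, Im in *; lra.
Qed.

Lemma re_sqrt_pos (w : C) : 0 <= re_sqrt w.
Proof. apply sqrt_pos. Qed.

(** Passing from [w] to [v] raises (|w| + Re w) / 2 by at most |v - w|, and sqrt (x + y) <= sqrt x +
    sqrt y. This gives continuity also across the negative axis, where the principal root itself
    jumps. *)
Lemma re_sqrt_holder (v w : C) : re_sqrt v <= re_sqrt w + sqrt (Cmod (v - w)).
Proof.
  destruct (Cmod_abs_le w) as [Hw _]; apply Rabs_le_between in Hw.
  destruct (Cmod_abs_le v) as [Hv _]; apply Rabs_le_between in Hv.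
  destruct (Cmod_abs_le (v - w)) as [Hvw _]; apply Rabs_le_between in Hvw; simpl in Hvw.
  pose proof (Cmod_minus_ge v w).
  unfold re_sqrt, Re.
  set (x := (Cmod w + fst w) / 2); set (y := Cmod (v - w)) in *.
  assert (Hx : 0 <= x) by (unfold x; lra).
  assert (Hy : 0 <= y) by apply Cmod_ge_0.
  pose proof (sqrt_sqrt x Hx); pose proof (sqrt_sqrt y Hy).
  pose proof (sqrt_pos x); pose proof (sqrt_pos y).
  rewrite <- (sqrt_square (sqrt x + sqrt y)) by lra.
  apply sqrt_le_1_alt.
  assert (0 <= sqrt x * sqrt y) by (apply Rmult_le_pos; assumption).
  replace ((sqrt x + sqrt y) * (sqrt x + sqrt y)) with
    (sqrt x * sqrt x + sqrt y * sqrt y + 2 * (sqrt x * sqrt y)) by ring.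
  unfold x in *; lra.
Qed.

Lemma disc_continuous_re_sqrt (f : C -> C) :
  holomorphic f -> disc_continuous (fun z => re_sqrt (f z)).
Proof.
  intros Hf z Hz e He; destruct (Hf z Hz) as [l Hl].
  destruct (cderiv_continuous _ _ _ Hl (e * e)) as [d [Hd H]].
  { apply Rmult_lt_0_compat; exact He. }
  exists d; split; [exact Hd|]; intros w Hw; specialize (H w Hw).
  assert (Hs : sqrt (Cmod (f w - f z)) < e).
  { rewrite <- (sqrt_square e) by lra; apply sqrt_lt_1_alt; split; [apply Cmod_ge_0|exact H]. }
  pose proof (re_sqrt_holder (f w) (f z)); pose proof (re_sqrt_holder (f z) (f w)) as H2.
  rewrite Cmod_minus_sym in H2; apply Rabs_def1; lra.
Qed.

(* If [P] is nearly a square root of [w], it is close to one of the two square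
   roots of [w], and [re_sqrt w] dominates the real parts of both. *)
Lemma re_sqrt_ge_approx (w P : C) (m : R) :
  0 < m -> m <= Cmod P -> Re P - Cmod (w - P * P) / m <= re_sqrt w.
Proof.
  intros Hm HP.
  assert (Hmain : forall g, (g * g)%C = w -> m <= Cmod (g + P) ->
    Re P - Cmod (w - P * P) / m <= re_sqrt w).
  { intros g Hg Hgm.
    assert (H1 : m * Cmod (g - P) <= Cmod (w - P * P)).
    { replace (w - P * P)%C with ((g + P) * (g - P))%C by (rewrite <- Hg; ring).
      rewrite Cmod_mult; apply Rmult_le_compat_r; [apply Cmod_ge_0|exact Hgm]. }
    assert (H2 : Cmod (g - P) <= Cmod (w - P * P) / m).
    { apply Rmult_le_reg_l with m; [exact Hm|].
      replace (m * (Cmod (w - P * P) / m)) with (Cmod (w - P * P)) by (field; lra).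
      exact H1. }
    destruct (Cmod_abs_le (g - P)) as [H3 _]; apply Rabs_le_between in H3; simpl in H3.
    rewrite <- Hg, re_sqrt_square, Hg.
    pose proof (Rle_abs (Re g)); unfold Re in *; lra. }
  destruct (Csqrt_exists w) as [g [Hg _]].
  (* Since (g + P) + (-g + P) = 2 P has modulus at least 2 m, one of the roots g and -g satisfies
     the hypothesis of [Hmain]. *)
  destruct (Rle_dec m (Cmod (g + P))) as [H|H]; [apply (Hmain g); assumption|].
  apply (Hmain (- g)%C); [rewrite <- Hg; ring|].
  pose proof (Cmod_triangle (g + P) (- g + P)) as Ht.
  replace (g + P + (- g + P))%C with (RtoC 2 * P)%C in Ht by ring.
  rewrite Cmod_mult, Cmod_R, Rabs_pos_eq in Ht by lra; lra.
Qed.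

(** At a zero of [f] the value 0 is a minimum. Elsewhere the quadratic Taylor polynomial has an
    approximate root P(h) = s + p1 h + p2 h^2 whose four values average exactly to [s]. Its real
    part bounds [re_sqrt] from below near [z] up to O(|h|^3), with equality at h = 0, so crossing
    the negative axis does no harm. *)
Lemma submean_re_sqrt (f : C -> C) : holomorphic f -> submean (fun z => re_sqrt (f z)).
Proof.
  intros Hf z Hz; destruct (Ceq_dec (f z) 0) as [H0|H0].
  { exists 0, 1; repeat split; [lra|lra|]; intros h _; rewrite H0.
    replace (re_sqrt 0) with 0.
    - pose proof (re_sqrt_pos (f (z + h)%C)); pose proof (re_sqrt_pos (f (z + - h)%C)).
      pose proof (re_sqrt_pos (f (z + Ci * h)%C)); pose proof (re_sqrt_pos (f (z + - (Ci * h))%C)).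
      lra.
    - unfold re_sqrt; rewrite Cmod_0; simpl; rewrite Rplus_0_r, Rdiv_0_l, sqrt_0; reflexivity. }
  destruct (holomorphic_taylor2 f z Hf Hz) as (c1 & c2 & M & d & HM & Hd & H).
  destruct (Csqrt_exists (f z)) as [s [Hs HsR]].
  assert (Hs0 : s <> RtoC 0) by (intros ->; apply H0; rewrite <- Hs; ring).
  pose proof (proj1 (Cmod_gt_0 s) Hs0) as Hsm.
  (* Matching coefficients in P(h)^2: 2 s p1 = c1 and 2 s p2 + p1^2 = c2. *)
  set (p1 := (c1 / (2 * s))%C); set (p2 := ((c2 - p1 * p1) / (2 * s))%C).
  set (P := fun h => (s + p1 * h + p2 * (h * h))%C).
  assert (H2s : (RtoC 2 * s)%C <> RtoC 0).
  { apply Cmult_neq_0; [|exact Hs0]; intros E; apply RtoC_inj in E; lra. }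
  assert (Hc1 : c1 = (2 * s * p1)%C) by (unfold p1; field; auto).
  assert (Hc2 : c2 = (2 * s * p2 + p1 * p1)%C) by (unfold p2; field; auto).
  pose proof (Cmod_ge_0 p1) as Hp1; pose proof (Cmod_ge_0 p2) as Hp2.
  set (m := Cmod s / 2).
  (* P(h)^2 exceeds the Taylor polynomial by 2 p1 p2 h^3 + p2^2 h^4; for |h| <= 1 the quartic term
     is absorbed into the cubic bound. *)
  set (M1 := M + 2 * (Cmod p1 * Cmod p2) + Cmod p2 * Cmod p2).
  set (Q := 1 + Cmod p1 + Cmod p2).
  assert (HmQ : 0 < m / Q) by (apply Rdiv_lt_0_compat; unfold m, Q; lra).
  assert (Hpp : 0 <= Cmod p1 * Cmod p2) by (apply Rmult_le_pos; assumption).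
  assert (Hpp2 : 0 <= Cmod p2 * Cmod p2) by (apply Rmult_le_pos; assumption).
  assert (Hkey : forall h, Cmod h < Rmin d (Rmin 1 (m / Q)) ->
    Re (P h) - M1 / m * (Cmod h * (Cmod h * Cmod h)) <= re_sqrt (f (z + h)%C)).
  { intros h Hh.
    pose proof (Rmin_l d (Rmin 1 (m / Q))); pose proof (Rmin_r d (Rmin 1 (m / Q))).
    pose proof (Rmin_l 1 (m / Q)); pose proof (Rmin_r 1 (m / Q)).
    pose proof (Cmod_ge_0 h) as Hh0; specialize (H h ltac:(lra)).
    set (a := Cmod h) in *.
    assert (Ha3 : 0 <= a * (a * a)) by (repeat apply Rmult_le_pos; assumption).
    assert (HPm : m <= Cmod (P h)).
    { assert (HP1 : Cmod s - Cmod (p1 * h + p2 * (h * h)) <= Cmod (P h)).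
      { pose proof (Cmod_minus_ge s (- (p1 * h + p2 * (h * h)))%C) as E.
        rewrite Cmod_opp in E; unfold P.
        replace (s + p1 * h + p2 * (h * h))%C with (s - - (p1 * h + p2 * (h * h)))%C by ring.
        exact E. }
      assert (Cmod (p1 * h + p2 * (h * h)) <= Q * a).
      { eapply Rle_trans; [apply Cmod_triangle|]; rewrite !Cmod_mult; fold a.
        assert (Haa : a * a <= 1 * a) by (apply Rmult_le_compat_r; lra).
        pose proof (Rmult_le_compat_l _ _ _ Hp2 Haa); unfold Q; lra. }
      assert (Q * a <= Q * (m / Q)) by (apply Rmult_le_compat_l; [unfold Q|]; lra).
      replace (Q * (m / Q)) with m in * by (field; unfold Q; lra).
      unfold m in *; lra. }
    assert (Hm : 0 < m) by (unfold m; lra).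
    eapply Rle_trans; [|apply (re_sqrt_ge_approx _ (P h) m Hm HPm)].
    apply Rplus_le_compat_l, Ropp_le_contravar.
    replace (M1 / m * (a * (a * a))) with (M1 * (a * (a * a)) / m) by (field; lra).
    apply Rmult_le_compat_r; [left; apply Rinv_0_lt_compat, Hm|].
    replace (f (z + h) - P h * P h)%C with
      ((f (z + h) - f z - c1 * h - c2 * (h * h)) +
       - (RtoC 2 * (p1 * p2) * (h * (h * h)) + p2 * p2 * (h * (h * (h * h)))))%C
      by (rewrite Hc1, Hc2, <- Hs; unfold P; ring).
    eapply Rle_trans; [apply Cmod_triangle|]; rewrite Cmod_opp.
    pose proof (Cmod_triangle (RtoC 2 * (p1 * p2) * (h * (h * h))) (p2 * p2 * (h * (h * (h * h))))) as T.
    rewrite !Cmod_mult, Cmod_R, Rabs_pos_eq in T by lra; fold a in T.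
    assert (a * (a * (a * a)) <= 1 * (a * (a * a))) by (apply Rmult_le_compat_r; lra).
    assert (Cmod p2 * Cmod p2 * (a * (a * (a * a))) <= Cmod p2 * Cmod p2 * (1 * (a * (a * a))))
      by (apply Rmult_le_compat_l; assumption).
    unfold M1; lra. }
  exists (4 * (M1 / m)), (Rmin d (Rmin 1 (m / Q))); repeat split.
  - assert (0 < / m) by (apply Rinv_0_lt_compat; unfold m; lra).
    apply Rmult_le_pos; [lra|]; apply Rmult_le_pos; unfold M1; lra.
  - repeat apply Rmin_pos; lra.
  - intros h Hh.
    pose proof (Hkey h Hh) as E1.
    pose proof (Hkey (- h)%C ltac:(rewrite Cmod_opp; exact Hh)) as E2.
    pose proof (Hkey (Ci * h)%C ltac:(rewrite Cmod_Ci_mult; exact Hh)) as E3.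
    pose proof (Hkey (- (Ci * h))%C ltac:(rewrite Cmod_opp, Cmod_Ci_mult; exact Hh)) as E4.
    rewrite !Cmod_opp in E2, E4; rewrite !Cmod_Ci_mult in E3, E4.
    assert (HR : Re (P h) + Re (P (- h)%C) + Re (P (Ci * h)%C) + Re (P (- (Ci * h))%C)
      = 4 * re_sqrt (f z)).
    { rewrite <- HsR; unfold P, Re; simpl; ring. }
    lra.
Qed.

Lemma disc_continuous_plus (u v : C -> R) :
  disc_continuous u -> disc_continuous v -> disc_continuous (fun z => u z + v z).
Proof.
  intros Hu Hv z Hz e He.
  destruct (Hu z Hz (e / 2)) as [d1 [Hd1 E1]]; [lra|].
  destruct (Hv z Hz (e / 2)) as [d2 [Hd2 E2]]; [lra|].
  exists (Rmin d1 d2); split; [apply Rmin_pos; assumption|].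
  intros w Hw; pose proof (Rmin_l d1 d2); pose proof (Rmin_r d1 d2).
  specialize (E1 w ltac:(lra)); specialize (E2 w ltac:(lra)).
  apply Rabs_def2 in E1; apply Rabs_def2 in E2; apply Rabs_def1; lra.
Qed.

Lemma submean_plus (u v : C -> R) : submean u -> submean v -> submean (fun z => u z + v z).
Proof.
  intros Hu Hv z Hz.
  destruct (Hu z Hz) as (M1 & d1 & HM1 & Hd1 & E1).
  destruct (Hv z Hz) as (M2 & d2 & HM2 & Hd2 & E2).
  exists (M1 + M2), (Rmin d1 d2); repeat split; [lra|apply Rmin_pos; assumption|].
  intros h Hh; pose proof (Rmin_l d1 d2); pose proof (Rmin_r d1 d2).
  specialize (E1 h ltac:(lra)); specialize (E2 h ltac:(lra)); lra.
Qed.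

Lemma disc_continuous_rotation (u : C -> R) (c : C) : Cmod c = 1 ->
  disc_continuous u -> disc_continuous (fun z => u (z * c)%C).
Proof.
  intros Hc Hu z Hz e He.
  destruct (Hu (z * c)%C) with (e := e) as [d [Hd E]];
    [rewrite Cmod_mult, Hc; lra|exact He|].
  exists d; split; [exact Hd|]; intros w Hw; apply E.
  replace (w * c - z * c)%C with ((w - z) * c)%C by ring.
  rewrite Cmod_mult, Hc; lra.
Qed.

Lemma submean_rotation (u : C -> R) (c : C) : Cmod c = 1 ->
  submean u -> submean (fun z => u (z * c)%C).
Proof.
  intros Hc Hu z Hz.
  destruct (Hu (z * c)%C) as (M & d & HM & Hd & E); [rewrite Cmod_mult, Hc; lra|].
  exists M, d; repeat split; try assumption; intros h Hh.
  specialize (E (h * c)%C); rewrite !Cmod_mult, Hc, Rmult_1_r in E.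
  replace ((z + h) * c)%C with (z * c + h * c)%C by ring.
  replace ((z + - h) * c)%C with (z * c + - (h * c))%C by ring.
  replace ((z + Ci * h) * c)%C with (z * c + Ci * (h * c))%C by ring.
  replace ((z + - (Ci * h)) * c)%C with (z * c + - (Ci * (h * c)))%C by ring.
  apply E, Hh.
Qed.

(** * Polar coordinates and the maximum principle *)

Lemma polar_form (z : C) : exists t, 0 <= t <= 2 * PI /\ z = circle (Cmod z) t.
Proof.
  pose proof PI_RGT_0 as HPI.
  destruct (Req_dec (Cmod z) 0) as [H0|H0].
  { exists 0; split; [lra|]; rewrite H0, (Cmod_eq_0 _ H0); unfold circle, RtoC.
    f_equal; ring. }
  pose proof (Cmod_ge_0 z) as Hp.
  set (m := Cmod z) in *.
  destruct (Cmod_abs_le z) as [Hre _]; fold m in Hre; apply Rabs_le_between in Hre.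
  assert (Hm2 : m * m = fst z * fst z + snd z * snd z).
  { pose proof (Cmod2_alt z) as E; fold m in E; unfold Re, Im in E; lra. }
  set (x := fst z / m).
  assert (Hx : -1 <= x <= 1).
  { unfold x; split; [apply Rle_div_r|apply Rle_div_l]; lra. }
  assert (Hxm : m * x = fst z) by (unfold x; field; exact H0).
  assert (Hsin : m * sin (acos x) = Rabs (snd z)).
  { rewrite sin_acos by exact Hx.
    rewrite <- (sqrt_square m) at 1 by lra.
    rewrite <- sqrt_mult_alt by (apply Rmult_le_pos; lra).
    rewrite <- sqrt_Rsqr_abs; f_equal; unfold Rsqr.
    replace (m * m * (1 - x * x)) with (m * m - (m * x) * (m * x)) by ring.
    rewrite Hxm; lra. }
  pose proof (acos_bound x) as Hb.
  destruct (Rle_dec 0 (snd z)) as [Hi|Hi].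
  - exists (acos x); split; [lra|]; apply injective_projections; simpl.
    + rewrite cos_acos by exact Hx; lra.
    + rewrite Hsin, Rabs_pos_eq by exact Hi; reflexivity.
  - exists (2 * PI - acos x); split; [lra|]; apply injective_projections; simpl.
    + rewrite cos_minus, cos_2PI, sin_2PI, cos_acos by exact Hx; lra.
    + rewrite sin_minus, cos_2PI, sin_2PI.
      rewrite Rabs_left in Hsin by lra; lra.
Qed.

Lemma circle_scal (r t : R) : circle r t = (RtoC r * circle 1 t)%C.
Proof. apply injective_projections; simpl; ring. Qed.

Lemma circle_rotation (r t s : R) : (circle r t * circle 1 s)%C = circle r (t + s).
Proof.
  apply injective_projections; simpl; [rewrite cos_plus|rewrite sin_plus]; ring.
Qed.

Lemma circle_continuous (p q e : R) : 0 < e -> exists d, 0 < d /\ forall x y,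
  Rabs (x - p) < d -> Rabs (y - q) < d -> Cmod (circle x y - circle p q) < e.
Proof.
  intros He; pose proof (Rabs_pos p) as Hp.
  assert (He' : 0 < e / 2 / (Rabs p + 1)) by (repeat apply Rdiv_lt_0_compat; lra).
  destruct (differentiable_eps _ (differentiable_circle 1 Rlt_0_1) q _ He') as [d [Hd H]].
  exists (Rmin d (e / 2)); split; [apply Rmin_pos; lra|].
  intros x y Hx Hy; pose proof (Rmin_l d (e / 2)); pose proof (Rmin_r d (e / 2)).
  specialize (H y ltac:(lra)).
  rewrite (circle_scal x), (circle_scal p).
  replace (x * circle 1 y - p * circle 1 q)%C with
    (RtoC (x - p) * circle 1 y + RtoC p * (circle 1 y - circle 1 q))%C
    by (rewrite RtoC_minus; ring).
  eapply Rle_lt_trans; [apply Cmod_triangle|].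
  rewrite !Cmod_mult, !Cmod_R, Cmod_circle by lra.
  assert (Rabs p * Cmod (circle 1 y - circle 1 q) <= (Rabs p + 1) * (e / 2 / (Rabs p + 1)))
    by (apply Rmult_le_compat; try apply Cmod_ge_0; lra).
  replace ((Rabs p + 1) * (e / 2 / (Rabs p + 1))) with (e / 2) in * by (field; lra).
  lra.
Qed.

Lemma Cmod_sqr (z : C) : Cmod z * Cmod z = fst z * fst z + snd z * snd z.
Proof. pose proof (Cmod2_alt z) as E; unfold Re, Im in E; lra. Qed.

(** Polar coordinates turn the closed disc into a rectangle, on which u + e |z|^2 attains its
    maximum. The four-point inequality forbids a maximum inside, and on the circle the perturbation
    is at most [e], which is the slack in the conclusion. *)
Lemma maximum_principle (u : C -> R) (s e : R) (p : C) :
  disc_continuous u -> submean u -> 0 < s < 1 -> 0 < e -> Cmod p <= s ->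
  exists t, 0 <= t <= 2 * PI /\ u p <= u (circle s t) + e.
Proof.
  intros Hc Hu Hs He Hp; pose proof PI_RGT_0 as HPI.
  set (g := fun x y => u (circle x y) + e * (x * x)).
  destruct (rectangle_max g 0 0 s (2 * PI)) as (x & y & Hx & Hy & Hmax); [lra|lra| |].
  - intros x y Hx Hy e' He'; unfold g.
    destruct (Hc (circle x y)) with (e := e' / 2) as [d1 [Hd1 E1]];
      [rewrite Cmod_circle; lra|lra|].
    destruct (circle_continuous x y d1 Hd1) as [d2 [Hd2 E2]].
    assert (Hd3 : 0 < e' / 2 / (2 * e)) by (repeat apply Rdiv_lt_0_compat; lra).
    exists (Rmin d2 (e' / 2 / (2 * e))); split; [apply Rmin_pos; assumption|].
    intros x' y' Hx' Hy' Hxx Hyy.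
    pose proof (Rmin_l d2 (e' / 2 / (2 * e))); pose proof (Rmin_r d2 (e' / 2 / (2 * e))).
    specialize (E1 _ (E2 x' y' ltac:(lra) ltac:(lra))).
    replace (u (circle x' y') + e * (x' * x') - (u (circle x y) + e * (x * x))) with
      (u (circle x' y') - u (circle x y) + e * (x' + x) * (x' - x)) by ring.
    eapply Rle_lt_trans; [apply Rabs_triang|].
    rewrite !Rabs_mult, (Rabs_pos_eq e), (Rabs_pos_eq (x' + x)) by lra.
    assert (e * (x' + x) * Rabs (x' - x) <= e * 2 * (e' / 2 / (2 * e))).
    { apply Rmult_le_compat; [apply Rmult_le_pos; lra|apply Rabs_pos| |lra].
      apply Rmult_le_compat_l; lra. }
    replace (e * 2 * (e' / 2 / (2 * e))) with (e' / 2) in * by (field; lra).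
    lra.
  - rewrite Rplus_0_l in Hx, Hy.
    assert (Hle : forall w, Cmod w <= s ->
      u w + e * (Cmod w * Cmod w) <= u (circle x y) + e * (x * x)).
    { intros w Hw; destruct (polar_form w) as [t [Ht Hwt]].
      pose proof (Cmod_ge_0 w).
      rewrite Hwt at 1; apply (Hmax (Cmod w) t); lra. }
    destruct (Req_dec x s) as [->|Hxs].
    + exists y; split; [exact Hy|].
      specialize (Hle p Hp); pose proof (Cmod_ge_0 p).
      assert (0 <= e * (Cmod p * Cmod p)) by (repeat apply Rmult_le_pos; lra).
      assert (e * (s * s) <= e * (1 * 1)).
      { apply Rmult_le_compat_l; [lra|]; apply Rmult_le_compat; lra. }
      lra.
    + exfalso; set (w := circle x y) in *.
      assert (Hw : Cmod w = x) by (apply Cmod_circle; lra).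
      destruct (Hu w) as (M & d & HM & Hd & E); [lra|].
      assert (HM1 : 0 < 2 * e / (M + 1)) by (apply Rdiv_lt_0_compat; lra).
      (* The step is within the range of the four-point inequality, keeps the four points in the
         disc of radius [s], and makes the loss M r^3 smaller than the gain 4 e r^2. *)
      set (r := Rmin (Rmin (d / 2) (s - x)) (2 * e / (M + 1))).
      assert (Hr : 0 < r) by (repeat apply Rmin_pos; lra).
      pose proof (Rmin_l (Rmin (d / 2) (s - x)) (2 * e / (M + 1))) as R1; fold r in R1.
      pose proof (Rmin_r (Rmin (d / 2) (s - x)) (2 * e / (M + 1))) as R2; fold r in R2.
      pose proof (Rmin_l (d / 2) (s - x)); pose proof (Rmin_r (d / 2) (s - x)).
      assert (Hrm : Cmod (RtoC r) = r) by (rewrite Cmod_R, Rabs_pos_eq; lra).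
      specialize (E r); rewrite Hrm in E; specialize (E ltac:(lra)).
      assert (Hadd : forall h, Cmod h = r -> Cmod (w + h) <= s).
      { intros h Hh; eapply Rle_trans; [apply Cmod_triangle|]; lra. }
      pose proof (Hle (w + r)%C (Hadd _ Hrm)) as L1.
      pose proof (Hle (w + - r)%C (Hadd (- RtoC r)%C ltac:(rewrite Cmod_opp; exact Hrm))) as L2.
      pose proof (Hle (w + Ci * r)%C (Hadd (Ci * RtoC r)%C ltac:(rewrite Cmod_Ci_mult; exact Hrm))) as L3.
      pose proof (Hle (w + - (Ci * r))%C
        (Hadd (- (Ci * RtoC r))%C ltac:(rewrite Cmod_opp, Cmod_Ci_mult; exact Hrm))) as L4.
      assert (Hsq : Cmod (w + r) * Cmod (w + r) + Cmod (w + - r) * Cmod (w + - r)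
        + Cmod (w + Ci * r) * Cmod (w + Ci * r) + Cmod (w + - (Ci * r)) * Cmod (w + - (Ci * r))
        = 4 * (x * x) + 4 * (r * r)).
      { rewrite <- Hw at 1; rewrite <- Hw; rewrite !Cmod_sqr; simpl; ring. }
      apply (f_equal (Rmult e)) in Hsq.
      assert (HMr : M * r < 4 * e).
      { assert (M * r <= (M + 1) * (2 * e / (M + 1))) by (apply Rmult_le_compat; lra).
        replace ((M + 1) * (2 * e / (M + 1))) with (2 * e) in * by (field; lra). lra. }
      assert (r * r * (M * r) < r * r * (4 * e)).
      { apply Rmult_lt_compat_l; [apply Rmult_lt_0_compat; lra|exact HMr]. }
      lra.
Qed.

(** * Sums over rotations and monotonicity of circle means *)

Fixpoint rotation_sum (u : C -> R) (h : R) (n : nat) (z : C) : R :=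
  match n with
  | O => 0
  | S n => rotation_sum u h n z + u (z * circle 1 (INR n * h))%C
  end.

Lemma rotation_sum_disc_continuous (u : C -> R) (h : R) (n : nat) :
  disc_continuous u -> disc_continuous (rotation_sum u h n).
Proof.
  intros Hu; induction n as [|n IH]; simpl.
  - intros z Hz e He; exists 1; split; [lra|]; intros; rewrite Rminus_diag, Rabs_R0; exact He.
  - apply disc_continuous_plus; [exact IH|].
    apply disc_continuous_rotation; [apply Cmod_circle; lra|exact Hu].
Qed.

Lemma rotation_sum_submean (u : C -> R) (h : R) (n : nat) :
  submean u -> submean (rotation_sum u h n).
Proof.
  intros Hu; induction n as [|n IH]; simpl.
  - intros z Hz; exists 0, 1; repeat split; try lra; intros; lra.
  - apply submean_plus; [exact IH|].
    apply submean_rotation; [apply Cmod_circle; lra|exact Hu].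
Qed.

(** By [circle_rotation], the sum at [circle r x] samples [u] at the angles x, x + h, ..., so it is
    a left Riemann sum. The start [x] is arbitrary because the maximum principle returns an
    unspecified angle. *)
Lemma rotation_sum_riemann (u : C -> R) (r a b d e h x : R) (n : nat) :
  0 < h < d -> a <= x -> x + INR n * h <= b ->
  (forall y y', ex_RInt (fun t => u (circle r t)) y y') ->
  (forall y y', a <= y <= b -> a <= y' <= b -> Rabs (y - y') < d ->
    Rabs (u (circle r y) - u (circle r y')) < e) ->
  Rabs (RInt (fun t => u (circle r t)) x (x + INR n * h)
    - h * rotation_sum u h n (circle r x)) <= INR n * h * e.
Proof.
  intros Hh Hx Hb Hex Hu; revert Hb; induction n as [|n IH]; intros Hb.
  - simpl; rewrite Rmult_0_l, Rplus_0_r, RInt_point, Rmult_0_r.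
    unfold zero; simpl; rewrite Rminus_0_r, Rabs_R0; lra.
  - rewrite S_INR in Hb |- *; cbn [rotation_sum]; rewrite circle_rotation.
    assert (Hn : 0 <= INR n * h) by (apply Rmult_le_pos; [apply pos_INR|lra]).
    specialize (IH ltac:(lra)).
    set (y := x + INR n * h) in *.
    replace (x + (INR n + 1) * h) with (y + h) in * by (unfold y; ring).
    assert (Hy : x <= y) by (unfold y; lra).
    set (v := fun t => u (circle r t)) in *.
    assert (E : RInt v x (y + h) = RInt v x y + RInt v y (y + h)).
    { symmetry; apply (RInt_Chasles v); apply Hex. }
    assert (E2 : RInt (fun t => v t - v y) y (y + h) = RInt v y (y + h) - h * v y).
    { rewrite (RInt_minus (V := R_CompleteNormedModule) v (fun _ => v y));
        [|apply Hex|apply ex_RInt_const].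
      rewrite RInt_const; unfold minus, plus, opp, scal; simpl; unfold mult; simpl; ring. }
    assert (E3 : Rabs (RInt (fun t => v t - v y) y (y + h)) <= (y + h - y) * e).
    { apply abs_RInt_le_const; [lra| |].
      - apply (ex_RInt_minus (V := R_NormedModule) v); [apply Hex|apply ex_RInt_const].
      - intros t Ht; left; apply Hu; try lra; rewrite Rabs_pos_eq; lra. }
    rewrite E2 in E3; rewrite E.
    apply Rabs_le_between in IH; apply Rabs_le_between in E3; apply Rabs_le_between.
    change (u (circle r y)) with (v y); lra.
Qed.

(** Brings an integral over one turn from that unspecified angle back to the interval from 0. *)
Lemma RInt_period (v : R -> R) (T x : R) :
  (forall t, continuous v t) -> (forall t, v (t + T) = v t) ->
  RInt v x (x + T) = RInt v 0 T.
Proof.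
  intros Hc Hp.
  assert (Hex : forall a b, ex_RInt v a b).
  { intros a b; apply (ex_RInt_continuous (V := R_CompleteNormedModule)); auto. }
  assert (E : RInt v T (x + T) = RInt v 0 x).
  { transitivity (RInt (fun t => scal 1 (v (1 * t + T))) 0 x).
    - refine (eq_trans _ (eq_sym (RInt_comp_lin (V := R_CompleteNormedModule)
        v 1 T 0 x (Hex _ _)))).
      f_equal; ring.
    - apply RInt_ext; intros t _; rewrite (Rmult_1_l t), Hp; exact (Rmult_1_l (v t)). }
  pose proof (RInt_Chasles v x 0 (x + T) (Hex _ _) (Hex _ _)) as E1.
  pose proof (RInt_Chasles v 0 T (x + T) (Hex _ _) (Hex _ _)) as E2.
  pose proof (opp_RInt_swap v 0 x (Hex _ _)) as E3.
  unfold plus, opp in *; simpl in *; lra.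
Qed.

Definition circle_mean (u : C -> R) (r : R) : R :=
  / (2 * PI) * RInt (fun t => u (circle r t)) 0 (2 * PI).

Lemma disc_continuous_circle (u : C -> R) (r t : R) :
  disc_continuous u -> 0 <= r < 1 -> continuous (fun t => u (circle r t)) t.
Proof.
  intros Hu Hr; apply continuous_eps; intros e He.
  destruct (Hu (circle r t)) with (e := e) as [d [Hd E]];
    [rewrite Cmod_circle; lra|exact He|].
  destruct (circle_continuous r t d Hd) as [d' [Hd' E']].
  exists d'; split; [exact Hd'|]; intros s Hs; apply E, E'; [|exact Hs].
  rewrite Rminus_diag, Rabs_R0; exact Hd'.
Qed.

(* By the maximum principle for the average of [u] over the rotations by
   multiples of [2 PI / N], whose values on a circle are Riemann sums. *)
Lemma circle_mean_monotone (u : C -> R) (r s : R) :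
  disc_continuous u -> submean u -> 0 <= r <= s -> 0 < s < 1 ->
  circle_mean u r <= circle_mean u s.
Proof.
  intros Hc Hu Hr Hs; pose proof PI_RGT_0 as HPI.
  apply Rmult_le_compat_l; [left; apply Rinv_0_lt_compat; lra|].
  set (I := fun r => RInt (fun t => u (circle r t)) 0 (2 * PI)).
  change (I r <= I s).
  apply Rnot_lt_le; intros Hlt.
  (* Three errors arise, each at most 2 PI e: two from Riemann sums and one from the maximum
     principle, scaled by h <= 2 PI. Together they stay below I r - I s = 8 PI e. *)
  set (e := (I r - I s) / (8 * PI)).
  assert (He : 0 < e) by (apply Rdiv_lt_0_compat; lra).
  assert (Hcont : forall q t, 0 <= q < 1 -> continuous (fun t => u (circle q t)) t).
  { intros q t Hq; apply disc_continuous_circle; assumption. }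
  assert (Hex : forall q, 0 <= q < 1 -> forall y y', ex_RInt (fun t => u (circle q t)) y y').
  { intros q Hq y y'; apply (ex_RInt_continuous (V := R_CompleteNormedModule)); auto. }
  (* The interval reaches 4 PI because a full turn may start at any angle up to 2 PI. *)
  destruct (@Heine_cor2 (fun t => u (circle r t)) 0 (4 * PI)) with (eps := mkposreal e He)
    as [d1 H1].
  { intros t _; apply continuity_pt_filterlim, Hcont; lra. }
  destruct (@Heine_cor2 (fun t => u (circle s t)) 0 (4 * PI)) with (eps := mkposreal e He)
    as [d2 H2].
  { intros t _; apply continuity_pt_filterlim, Hcont; lra. }
  assert (Hd : 0 < Rmin d1 d2 / (2 * PI)).
  { apply Rdiv_lt_0_compat; [apply Rmin_pos; apply cond_pos|lra]. }
  destruct (archimed_cor1 _ Hd) as [N [HN HN0]].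
  assert (HNpos : 1 <= INR N) by (change 1 with (INR 1); apply le_INR; lia).
  set (h := 2 * PI * / INR N).
  assert (Hh0 : 0 < h) by (apply Rmult_lt_0_compat; [lra|apply Rinv_0_lt_compat; lra]).
  assert (HNh : INR N * h = 2 * PI) by (unfold h; field; lra).
  assert (Hhd : h < Rmin d1 d2).
  { apply (Rmult_lt_compat_l (2 * PI)) in HN; [|lra].
    replace (2 * PI * (Rmin d1 d2 / (2 * PI))) with (Rmin d1 d2) in HN by (field; lra).
    exact HN. }
  pose proof (Rmin_l d1 d2); pose proof (Rmin_r d1 d2).
  destruct (maximum_principle (rotation_sum u h N) s e (circle r 0)) as [x [Hx Hmax]];
    [apply rotation_sum_disc_continuous, Hc | apply rotation_sum_submean, Hu
    | exact Hs | exact He | rewrite Cmod_circle; lra |].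
  pose proof (rotation_sum_riemann u r 0 (4 * PI) d1 e h 0 N ltac:(lra) ltac:(lra) ltac:(lra)
    (Hex r ltac:(lra)) H1) as R1.
  pose proof (rotation_sum_riemann u s 0 (4 * PI) d2 e h x N ltac:(lra) ltac:(lra) ltac:(lra)
    (Hex s ltac:(lra)) H2) as R2.
  rewrite HNh in R1, R2; rewrite Rplus_0_l in R1.
  rewrite (RInt_period (fun t => u (circle s t))) in R2.
  2: { intros t; apply Hcont; lra. }
  2: { intros t; unfold circle; rewrite cos_plus, sin_plus, cos_2PI, sin_2PI.
       do 2 f_equal; ring. }
  fold (I r) in R1; fold (I s) in R2.
  apply Rabs_le_between in R1; apply Rabs_le_between in R2.
  apply (Rmult_le_compat_l h) in Hmax; [|lra].
  assert (Hhe : h * e <= 2 * PI * e).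
  { apply Rmult_le_compat_r; [lra|]; rewrite <- HNh.
    rewrite <- (Rmult_1_l h) at 1; apply Rmult_le_compat_r; lra. }
  assert (I r - I s = 8 * (PI * e)) by (unfold e; field; lra).
  assert (0 < PI * e) by (apply Rmult_lt_0_compat; lra).
  lra.
Qed.

(** * The backward shift *)

Lemma cderiv_of_quadratic_error (f : C -> C) (z l : C) (K d : R) :
  0 <= K -> 0 < d ->
  (forall w, Cmod (w - z) < d ->
    Cmod (f w - f z - l * (w - z)) <= K * (Cmod (w - z) * Cmod (w - z))) ->
  cderiv f z l.
Proof.
  intros HK Hd H; split.
  - exists (Cmod l); split; [apply Cmod_ge_0|]; intros p; rewrite Cmod_mult; lra.
  - intros e He.
    assert (HeK : 0 < e / (K + 1)) by (apply Rdiv_lt_0_compat; lra).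
    exists (Rmin d (e / (K + 1))); split; [apply Rmin_pos; assumption|].
    intros w Hw; pose proof (Rmin_l d (e / (K + 1))); pose proof (Rmin_r d (e / (K + 1))).
    specialize (H w ltac:(lra)); eapply Rle_trans; [exact H|].
    pose proof (Cmod_ge_0 (w - z)).
    rewrite <- Rmult_assoc; apply Rmult_le_compat_r; [assumption|].
    replace e with ((K + 1) * (e / (K + 1))) by (field; lra).
    apply Rmult_le_compat; lra.
Qed.

Lemma cderiv_ext_loc (f g : C -> C) (z l : C) (d : R) :
  0 < d -> (forall w, Cmod (w - z) < d -> g w = f w) -> cderiv g z l -> cderiv f z l.
Proof.
  intros Hd Hfg [H1 H2]; split; [exact H1|].
  intros e He; destruct (H2 e He) as [d' [Hd' H]].
  exists (Rmin d d'); split; [apply Rmin_pos; assumption|].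
  intros w Hw; pose proof (Rmin_l d d'); pose proof (Rmin_r d d').
  rewrite <- (Hfg w), <- (Hfg z) by
    (replace (z - z)%C with (RtoC 0) by ring; rewrite ?Cmod_0; lra).
  apply H; lra.
Qed.

Lemma backward_shift_0 (f : C -> C) : backward_shift f 0 = C_derive f 0.
Proof.
  unfold backward_shift; destruct (Req_dec_T (Cmod 0) 0) as [_|H]; [reflexivity|].
  exfalso; apply H, Cmod_0.
Qed.

Lemma backward_shift_nonzero (f : C -> C) (z : C) :
  z <> 0 -> backward_shift f z = ((f z - f 0) / z)%C.
Proof.
  intros Hz; unfold backward_shift; destruct (Req_dec_T (Cmod z) 0) as [H|_]; [|reflexivity].
  exfalso; apply Hz, Cmod_eq_0, H.
Qed.

(** At 0 the expansion (f(w) - f(0)) / w = c1 + c2 w + O(|w|^2) removes the singularity: it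
    identifies [C_derive f 0] with [c1] and gives the derivative [c2]. Away from 0 the quotient is
    differentiated directly. *)
Lemma holomorphic_backward_shift (f : C -> C) : holomorphic f -> holomorphic (backward_shift f).
Proof.
  intros Hf z Hz; destruct (Ceq_dec z 0) as [->|Hz0].
  - destruct (holomorphic_taylor2 f 0 Hf Hz) as (c1 & c2 & M & d & HM & Hd & H).
    assert (H' : forall w, Cmod w < d ->
      Cmod (f w - f 0 - c1 * w - c2 * (w * w)) <= M * (Cmod w * (Cmod w * Cmod w))).
    { intros w Hw; specialize (H w Hw); rewrite Cplus_0_l in H; exact H. }
    assert (Hmin : 0 < Rmin 1 d) by (apply Rmin_pos; lra).
    pose proof (Rmin_l 1 d); pose proof (Rmin_r 1 d).
    assert (Hc1 : C_derive f 0 = c1).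
    { apply is_C_derive_unique, is_derive_cderiv.
      apply (cderiv_of_quadratic_error f 0 c1 (Cmod c2 + M) (Rmin 1 d));
        [pose proof (Cmod_ge_0 c2); lra|exact Hmin|].
      intros w; replace (w - 0)%C with w by ring; intros Hw.
      specialize (H' w ltac:(lra)); pose proof (Cmod_ge_0 w).
      replace (f w - f 0 - c1 * w)%C with
        ((f w - f 0 - c1 * w - c2 * (w * w)) + c2 * (w * w))%C by ring.
      eapply Rle_trans; [apply Cmod_triangle|]; rewrite !Cmod_mult.
      assert (M * (Cmod w * (Cmod w * Cmod w)) <= M * (1 * (Cmod w * Cmod w))).
      { apply Rmult_le_compat_l; [exact HM|]; apply Rmult_le_compat_r; [|lra].
        apply Rmult_le_pos; assumption. }
      lra. }
    exists c2; apply (cderiv_of_quadratic_error _ 0 c2 M (Rmin 1 d)); [exact HM|exact Hmin|].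
    intros w; replace (w - 0)%C with w by ring; intros Hw.
    rewrite backward_shift_0, Hc1.
    destruct (Ceq_dec w 0) as [->|Hw0].
    + rewrite backward_shift_0, Hc1; replace (c1 - c1 - c2 * 0)%C with (RtoC 0) by ring.
      rewrite Cmod_0; lra.
    + rewrite backward_shift_nonzero by exact Hw0.
      pose proof (proj1 (Cmod_gt_0 w) Hw0).
      apply Rmult_le_reg_r with (Cmod w); [assumption|].
      rewrite <- Cmod_mult.
      replace (((f w - f 0) / w - c1 - c2 * w) * w)%C with
        (f w - f 0 - c1 * w - c2 * (w * w))%C by (field; exact Hw0).
      eapply Rle_trans; [apply H'; lra|]; lra.
  - destruct (Hf z Hz) as [l Hl]; pose proof (proj1 (Cmod_gt_0 z) Hz0) as Hzp.
    assert (Hn : forall p : C, 0 <= Cmod (p - z)) by (intros; apply Cmod_ge_0).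
    pose proof (expands_mult _ _ _ _ _ _ _ Hn
      (expands_plus _ _ _ _ _ _ _ Hl (expands_const _ (- f 0)%C Hn)) (cderiv_inv z Hz0)) as X.
    exists ((f z + - f 0) * - / (z * z) + l * / z)%C.
    apply (cderiv_ext_loc _ (fun w => (f w + - f 0) * / w)%C z _ (Cmod z) Hzp).
    + intros w Hw; symmetry; apply backward_shift_nonzero; intros ->.
      replace (0 - z)%C with (- z)%C in Hw by ring; rewrite Cmod_opp in Hw; lra.
    + revert X; apply expands_ext; intros; ring.
Qed.

(* With [g] the principal square root of [w], this is AM-GM applied to
   [|w - 1| = |g - 1| |g + 1|], giving [|g - 1|^2 + |g + 1|^2 / 4]. *)
Lemma Cmod_minus_1_le (w : C) : Cmod (w - 1) <= 5 / 4 * Cmod w + 5 / 4 - 3 / 2 * re_sqrt w.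
Proof.
  destruct (Csqrt_exists w) as [g [<- <-]].
  replace (g * g - 1)%C with ((g - 1) * (g + 1))%C by ring.
  rewrite !Cmod_mult.
  pose proof (Cmod_sqr (g - 1)) as E1; pose proof (Cmod_sqr (g + 1)) as E2.
  pose proof (Cmod_sqr g) as E3; simpl in E1, E2.
  pose proof (Rle_0_sqr (Cmod (g - 1) - Cmod (g + 1) / 2)) as H; unfold Rsqr in H.
  unfold Re; lra.
Qed.

Lemma Cmod_minus_le (w a : C) : a <> 0 ->
  Cmod (w - a) <= 5 / 4 * Cmod w + 5 / 4 * Cmod a - 3 / 2 * Cmod a * re_sqrt (w * / a).
Proof.
  intros Ha; pose proof (Cmod_minus_1_le (w * / a)) as H.
  pose proof (proj1 (Cmod_gt_0 a) Ha) as Hp.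
  apply (Rmult_le_compat_l (Cmod a)) in H; [|lra].
  rewrite <- Cmod_mult in H.
  replace (a * (w * / a - 1))%C with (w - a)%C in H by (field; exact Ha).
  rewrite Cmod_mult, Cmod_inv in H by exact Ha.
  replace (Cmod a * (5 / 4 * (Cmod w * / Cmod a) + 5 / 4 - 3 / 2 * re_sqrt (w * / a)))
    with (5 / 4 * Cmod w + 5 / 4 * Cmod a - 3 / 2 * Cmod a * re_sqrt (w * / a)) in H
    by (field; lra).
  exact H.
Qed.

(** * Circle means as monotone linear functionals *)

Lemma disc_continuous_ex_RInt (u : C -> R) (r a b : R) :
  disc_continuous u -> 0 <= r < 1 -> ex_RInt (fun t => u (circle r t)) a b.
Proof.
  intros Hu Hr; apply (ex_RInt_continuous (V := R_CompleteNormedModule)).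
  intros t _; apply disc_continuous_circle; assumption.
Qed.

Lemma circle_mean_le (u v : C -> R) (r : R) :
  disc_continuous u -> disc_continuous v -> 0 <= r < 1 ->
  (forall z, Cmod z = r -> u z <= v z) -> circle_mean u r <= circle_mean v r.
Proof.
  intros Hu Hv Hr H; pose proof PI_RGT_0.
  apply Rmult_le_compat_l; [left; apply Rinv_0_lt_compat; lra|].
  apply RInt_le; [lra|apply disc_continuous_ex_RInt; assumption
    |apply disc_continuous_ex_RInt; assumption|].
  intros t _; apply H, Cmod_circle; lra.
Qed.

Lemma circle_mean_plus (u v : C -> R) (r : R) :
  disc_continuous u -> disc_continuous v -> 0 <= r < 1 ->
  circle_mean (fun z => u z + v z) r = circle_mean u r + circle_mean v r.
Proof.
  intros Hu Hv Hr; unfold circle_mean; rewrite <- Rmult_plus_distr_l; f_equal.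
  apply (RInt_plus (V := R_CompleteNormedModule)); apply disc_continuous_ex_RInt; assumption.
Qed.

Lemma circle_mean_scal (k : R) (u : C -> R) (r : R) :
  disc_continuous u -> 0 <= r < 1 ->
  circle_mean (fun z => k * u z) r = k * circle_mean u r.
Proof.
  intros Hu Hr; unfold circle_mean.
  rewrite <- Rmult_assoc, (Rmult_comm k), Rmult_assoc; f_equal.
  exact (RInt_scal (V := R_CompleteNormedModule) (fun t => u (circle r t)) 0 (2 * PI) k
    (disc_continuous_ex_RInt u r _ _ Hu Hr)).
Qed.

Lemma circle_mean_const (k r : R) : circle_mean (fun _ => k) r = k.
Proof.
  unfold circle_mean; rewrite RInt_const; pose proof PI_RGT_0.
  unfold scal; simpl; unfold mult; simpl; field; lra.
Qed.

(** Makes the sub-mean-value inequality at the centre the case of radius 0 in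
    [circle_mean_monotone]. *)
Lemma circle_mean_0 (u : C -> R) : circle_mean u 0 = u 0.
Proof.
  rewrite <- (circle_mean_const (u 0) 0); unfold circle_mean; f_equal.
  apply RInt_ext; intros t _; f_equal; unfold circle, RtoC; f_equal; ring.
Qed.

Lemma disc_continuous_const (k : R) : disc_continuous (fun _ => k).
Proof.
  intros z Hz e He; exists 1; split; [lra|]; intros; rewrite Rminus_diag, Rabs_R0; exact He.
Qed.

Lemma disc_continuous_scal (k : R) (u : C -> R) :
  disc_continuous u -> disc_continuous (fun z => k * u z).
Proof.
  intros Hu z Hz e He; pose proof (Rabs_pos k) as Hk.
  destruct (Hu z Hz (e / (Rabs k + 1))) as [d [Hd H]]; [apply Rdiv_lt_0_compat; lra|].
  exists d; split; [exact Hd|]; intros w Hw; specialize (H w Hw).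
  rewrite <- Rmult_minus_distr_l, Rabs_mult.
  replace e with ((Rabs k + 1) * (e / (Rabs k + 1))) by (field; lra).
  pose proof (Rabs_pos (u w - u z)).
  assert (Rabs k * Rabs (u w - u z) <= Rabs k * (e / (Rabs k + 1)))
    by (apply Rmult_le_compat_l; lra).
  assert (0 < e / (Rabs k + 1)) by (apply Rdiv_lt_0_compat; lra).
  lra.
Qed.

Lemma holomorphic_minus_const (f : C -> C) (a : C) :
  holomorphic f -> holomorphic (fun z => f z - a)%C.
Proof.
  intros Hf z Hz; destruct (Hf z Hz) as [l Hl]; exists l.
  assert (Hn : forall p : C, 0 <= Cmod (p - z)) by (intros; apply Cmod_ge_0).
  refine (expands_ext _ _ _ _ _ _ _ _ _ _
    (expands_plus _ _ _ _ _ _ _ Hl (expands_const _ (- a)%C Hn))); intros; ring.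
Qed.

Lemma holomorphic_mult_const (f : C -> C) (a : C) :
  holomorphic f -> holomorphic (fun z => f z * a)%C.
Proof.
  intros Hf z Hz; destruct (Hf z Hz) as [l Hl]; exists (l * a)%C.
  assert (Hn : forall p : C, 0 <= Cmod (p - z)) by (intros; apply Cmod_ge_0).
  refine (expands_ext _ _ _ _ _ _ _ _ _ _
    (expands_mult _ _ _ _ _ _ _ Hn Hl (expands_const _ a Hn))); intros; ring.
Qed.

Lemma circle_mean_minus_center (f : C -> C) (r : R) : holomorphic f -> 0 < r < 1 ->
  circle_mean (fun z => Cmod (f z - f 0)) r <= 5 / 4 * circle_mean (fun z => Cmod (f z)) r.
Proof.
  intros Hf Hr; set (a := f 0).
  pose proof (disc_continuous_Cmod f Hf) as Hc.
  pose proof (disc_continuous_Cmod _ (holomorphic_minus_const f a Hf)) as Hca.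
  (* When f(0) = 0 there is nothing to normalize by, and 1 <= 5/4 suffices. *)
  destruct (Ceq_dec a 0) as [Ha|Ha].
  - rewrite <- circle_mean_scal by (assumption || lra).
    apply circle_mean_le; [exact Hca|apply disc_continuous_scal, Hc|lra|].
    intros z _; rewrite Ha; replace (f z - 0)%C with (f z) by ring.
    pose proof (Cmod_ge_0 (f z)); lra.
  - set (u := fun z => re_sqrt (f z * / a)).
    pose proof (holomorphic_mult_const f (/ a) Hf) as Hfa.
    pose proof (disc_continuous_re_sqrt _ Hfa) as Hu.
    pose proof (circle_mean_monotone u 0 r Hu (submean_re_sqrt _ Hfa) ltac:(lra) ltac:(lra)) as Hm.
    rewrite circle_mean_0 in Hm; unfold u in Hm at 1; fold a in Hm.
    rewrite Cinv_r in Hm by exact Ha.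
    replace (re_sqrt 1) with 1 in Hm.
    2: { pose proof (re_sqrt_square 1) as E; rewrite Cmult_1_l in E.
         rewrite E; simpl; rewrite Rabs_R1; reflexivity. }
    set (v := fun z => 5 / 4 * Cmod (f z) + (5 / 4 * Cmod a + - (3 / 2 * Cmod a) * u z)).
    assert (Hv : circle_mean v r = 5 / 4 * circle_mean (fun z => Cmod (f z)) r
      + (5 / 4 * Cmod a + - (3 / 2 * Cmod a) * circle_mean u r)).
    { unfold v.
      rewrite (circle_mean_plus (fun z => 5 / 4 * Cmod (f z))
        (fun z => 5 / 4 * Cmod a + - (3 / 2 * Cmod a) * u z)),
        (circle_mean_plus (fun _ => 5 / 4 * Cmod a) (fun z => - (3 / 2 * Cmod a) * u z)),
        circle_mean_const, (circle_mean_scal _ u), (circle_mean_scal _ (fun z => Cmod (f z)));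
        try lra; try assumption;
        repeat (apply disc_continuous_plus || apply disc_continuous_scal
          || apply disc_continuous_const); assumption. }
    eapply Rle_trans; [apply (circle_mean_le _ v r Hca); [|lra|]|].
    + unfold v; repeat (apply disc_continuous_plus || apply disc_continuous_scal
        || apply disc_continuous_const); assumption.
    + intros z _; unfold v, u; pose proof (Cmod_minus_le (f z) a Ha); lra.
    + rewrite Hv; pose proof (Cmod_ge_0 a).
      assert (Cmod a * 1 <= Cmod a * circle_mean u r) by (apply Rmult_le_compat_l; assumption).
      lra.
Qed.

Lemma M1_circle_mean (f : C -> C) (r : R) : M1 r f = circle_mean (fun z => Cmod (f z)) r.
Proof. reflexivity. Qed.

Lemma M1_backward_shift_le (f : C -> C) (L r : R) : holomorphic f ->
  (forall s, 0 <= s < 1 -> M1 s f <= L) -> 0 <= r < 1 ->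
  M1 r (backward_shift f) <= 1.7047 * L.
Proof.
  intros Hf HL Hr.
  pose proof (holomorphic_backward_shift f Hf) as HB.
  (* In place of 3/4, any number below 1 and at least (5/4) / 1.7047, about 0.733, would serve. *)
  set (s := Rmax r (3 / 4)).
  pose proof (Rmax_l r (3 / 4)) as S1; pose proof (Rmax_r r (3 / 4)) as S2; fold s in S1, S2.
  assert (S3 : s < 1) by (apply Rmax_lub_lt; lra).
  pose proof (disc_continuous_Cmod f Hf) as Hc.
  pose proof (disc_continuous_Cmod _ HB) as HcB.
  pose proof (disc_continuous_Cmod _ (holomorphic_minus_const f (f 0) Hf)) as Hca.
  (* Passing from 5/3 L to 1.7047 L needs L >= 0, which the mean at radius 0, namely |f(0)|,
     provides. *)
  assert (HL0 : 0 <= L).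
  { eapply Rle_trans; [|apply (HL 0); lra].
    rewrite M1_circle_mean, circle_mean_0; apply Cmod_ge_0. }
  specialize (HL s ltac:(lra)); rewrite M1_circle_mean in *.
  pose proof (circle_mean_monotone _ r s HcB (submean_Cmod _ HB) ltac:(lra) ltac:(lra)) as Hm.
  assert (Hs : circle_mean (fun z => Cmod (backward_shift f z)) s <=
    circle_mean (fun z => 4 / 3 * Cmod (f z - f 0)) s).
  { apply circle_mean_le; [exact HcB|apply disc_continuous_scal, Hca|lra|].
    intros z Hz.
    assert (Hz0 : z <> 0) by (intros ->; rewrite Cmod_0 in Hz; lra).
    rewrite backward_shift_nonzero, Cmod_div, Hz by exact Hz0.
    unfold Rdiv at 1; rewrite Rmult_comm.
    apply Rmult_le_compat_r; [apply Cmod_ge_0|].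
    replace (4 / 3) with (/ (3 / 4)) by field.
    apply Rinv_le_contravar; lra. }
  rewrite (circle_mean_scal _ (fun z => Cmod (f z - f 0))) in Hs by (assumption || lra).
  pose proof (circle_mean_minus_center f s Hf ltac:(lra)) as Hd.
  lra.
Qed.

Lemma analytic_on_disc_holomorphic (f : C -> C) : analytic_on_disc f <-> holomorphic f.
Proof.
  split; intros H z Hz; destruct (H z Hz) as [l Hl]; exists l; apply is_derive_cderiv, Hl.
Qed.

Lemma M1_le_H1_norm (f : C -> C) (r : R) : 0 <= r < 1 -> Rbar_le (M1 r f) (H1_norm f).
Proof.
  intros Hr; apply (proj1 (Lub_Rbar_correct (fun y => exists r, 0 <= r < 1 /\ y = M1 r f))).
  exists r; auto.
Qed.

Lemma H1_norm_le (f : C -> C) (L : R) :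
  (forall r, 0 <= r < 1 -> M1 r f <= L) -> Rbar_le (H1_norm f) L.
Proof.
  intros H; apply (proj2 (Lub_Rbar_correct (fun y => exists r, 0 <= r < 1 /\ y = M1 r f))).
  intros y (r & Hr & ->); apply H, Hr.
Qed.

Theorem theorem2p4 :
  (forall f : C -> C, H1 f -> H1 (backward_shift f)) /\
  Rbar_le (H1_op_norm backward_shift) 1.7047.
Proof.
  split.
  - intros f [Ha Hn]; apply analytic_on_disc_holomorphic in Ha; split.
    { apply analytic_on_disc_holomorphic, holomorphic_backward_shift, Ha. }
    pose proof (M1_le_H1_norm f) as HM.
    destruct (H1_norm f) as [L| |].
    + eapply Rbar_le_lt_trans.
      * apply H1_norm_le; intros r Hr; apply (M1_backward_shift_le f L r Ha HM Hr).
      * exact I.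
    + destruct Hn.
    (* The norm is not [m_infty], being at least the finite mean at radius 0. *)
    + destruct (HM 0); lra.
  - apply (proj2 (proj2_sig (Rbar_ex_lub _))).
    intros y (f & [Ha _] & Hn & ->).
    apply analytic_on_disc_holomorphic in Ha.
    apply H1_norm_le; intros r Hr.
    (* On the unit ball the common bound for the means of [f] is L = 1. *)
    rewrite <- (Rmult_1_r 1.7047); apply M1_backward_shift_le; [exact Ha| |exact Hr].
    intros s Hs; exact (Rbar_le_trans _ _ _ (M1_le_H1_norm f s Hs) Hn).
Qed.
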